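(* Let $q\in\mathbb{C}\setminus\{0\}$ be not a root of unity, and let $m\ge 3$, $n\ge 4$. Each of the following sequences (chains) of $m$ types of $U_q(sl(2))$-actions on $A_q(n)$ gives module-algebra structures of $U_q(sl(m+1))$ on $A_q(n)$: (a) $D - D - \cdots - D$ ($m$ vertices); (b) $A_i - C_i - C_{i+1}-\cdots - C_{i+m-2}$, for $i\ge1$ with $i+m-2\le n-1$; (c) $C_i - C_{i+1}-\cdots - C_{i+m-2} - B_{i+m-1}$, for $i\ge 1$ with $i+m-2\le n-1$; (d) $C_i - C_{i+1}-\cdots - C_{i+m-1}$, for $i\ge 1$ with $i+m-1\le n-1$; (e) $A_1 - B_n - C_{n-1}-C_{n-2}-\cdots - C_{n+2-m}$, where $n+2-m>1$; (f) $B_n - A_1 - C_1 - C_2-\cdots - C_{m-2}$, where $m-2<n-1$. Every such chain $X_1-X_2-\cdots-X_m$ corresponds to two classes of module-algebra structures of $U_q(sl(m+1))$ on $A_q(n)$: the one in which, for every $1\le s\le m$, the actions of $k_s,e_s,f_s$ are of type $X_s$, and the one in which, for every $1\le s\le m$, the actions of $k_s,e_s,f_s$ are of type $X_{m+1-s}$.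
   Context: All algebras and vector spaces are over $\mathbb{C}$. $U_q(sl(m+1))$ ($m\ge 1$) is the unital algebra generated by $e_i,f_i,k_i,k_i^{-1}$ ($1\le i\le m$) with relations $k_ik_i^{-1}=k_i^{-1}k_i=1$, $k_ik_j=k_jk_i$, $k_ie_jk_i^{-1}=q^{a_{ij}}e_j$, $k_if_jk_i^{-1}=q^{-a_{ij}}f_j$, $[e_i,f_j]=\delta_{ij}\frac{k_i-k_i^{-1}}{q-q^{-1}}$; $e_ie_j=e_je_i$ and $f_if_j=f_jf_i$ if $a_{ij}=0$; $e_i^2e_j-(q+q^{-1})e_ie_je_i+e_je_i^2=0$ and $f_i^2f_j-(q+q^{-1})f_if_jf_i+f_jf_i^2=0$ if $a_{ij}=-1$. Here $a_{ii}=2$, $a_{ij}=-1$ if $|i-j|=1$, $a_{ij}=0$ if $|i-j|>1$. Its Hopf algebra structure is $\Delta(e_i)=1\otimes e_i+e_i\otimes k_i$, $\Delta(f_i)=k_i^{-1}\otimes f_i+f_i\otimes 1$, $\Delta(k_i^{\pm1})=k_i^{\pm1}\otimes k_i^{\pm1}$, $\varepsilon(k_i^{\pm1})=1$, $\varepsilon(e_i)=\varepsilon(f_i)=0$, $S(e_i)=-e_ik_i^{-1}$, $S(f_i)=-k_if_i$, $S(k_i^{\pm1})=k_i^{\mp1}$. The quantum $n$-space $A_q(n)$ is the unital algebra generated by $x_1,\dots,x_n$ with relations $x_ix_j=qx_jx_i$ for $i>j$. An $H$-module algebra structure on a unital algebra $A$, for a Hopf algebra $H$, is an algebra homomorphism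 $\pi:H\to \mathrm{End}_{\mathbb{C}}A$ with $\pi(h)(ab)=\sum_i\pi(h_i')(a)\pi(h_i'')(b)$ (where $\Delta(h)=\sum_i h_i'\otimes h_i''$) and $\pi(h)(1)=\varepsilon(h)1$; one writes $h(a)$ for $\pi(h)(a)$. It is determined by the values of the generators of $H$ on the generators of $A$. Types of actions of a triple $(k,e,f)$ (generating a copy of $U_q(sl(2))$) on $A_q(n)$: Type $D$: $k(x_i)=\pm x_i$ (arbitrary signs), $e(x_i)=f(x_i)=0$ for all $i$. Type $A_j$ ($1\le j\le n$): $k(x_i)=qx_i$ for $i<j$, $k(x_j)=q^{-2}x_j$, $k(x_i)=q^{-1}x_i$ for $i>j$; $e(x_i)=0$ for $i\ne j$, $e(x_j)=a_j$; $f(x_i)=a_j^{-1}x_ix_j$ for $i<j$, $f(x_j)=-qa_j^{-1}x_j^2$, $f(x_i)=-qa_j^{-1}x_jx_i$ for $i>j$; here $a_j\in\mathbb{C}\setminus\{0\}$. Type $B_j$ ($1\le j\le n$): $k(x_i)=qx_i$ for $i<j$, $k(x_j)=q^{2}x_j$, $k(x_i)=q^{-1}x_i$ for $i>j$; $e(x_i)=-qb_j^{-1}x_ix_j$ for $i<j$, $e(x_j)=-qb_j^{-1}x_j^2$, $e(x_i)=b_j^{-1}x_jx_i$ for $i>j$; $f(x_i)=0$ for $i\neq j$, $f(x_j)=b_j$; here $b_j\in\mathbb{C}\setminus\{0\}$. Type $C_j$ ($1\le j\le n-1$): $k(x_j)=qx_j$, $k(x_{j+1})=q^{-1}x_{j+1}$,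 $k(x_i)=x_i$ for $i\ne j,j+1$; $e(x_i)=0$ for $i\ne j+1$, $e(x_{j+1})=c_{j+1,j}x_j$; $f(x_i)=0$ for $i\ne j$, $f(x_j)=c_{j+1,j}^{-1}x_{j+1}$; here $c_{j+1,j}\in\mathbb{C}\setminus\{0\}$. *)

(* Defs.v *)
From HB Require Import structures.
From mathcomp Require Import all_boot all_order all_algebra.
From mathcomp Require Import boolp reals.
From mathcomp.real_closed Require Import complex.
From mathcomp.algebra_tactics Require Import ring.

Set Implicit Arguments.
Unset Strict Implicit.
Unset Printing Implicit Defensive.

Import Order.TTheory GRing.Theory Num.Theory.
Local Open Scope ring_scope.
Local Open Scope quotient_scope.

Inductive ncexpr (F : Type) (I : Type) :=
| NCgen of I
| NCcst of F
| NCadd of ncexpr F I & ncexpr F I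
| NCmul of ncexpr F I & ncexpr F I.

Arguments NCgen {F I}.
Arguments NCcst {F I}.

Declare Scope nc_scope.
Delimit Scope nc_scope with nc.
Bind Scope nc_scope with ncexpr.
Notation "x + y" := (NCadd x y) : nc_scope.
Notation "x * y" := (NCmul x y) : nc_scope.
Notation "c *: x" := (NCmul (NCcst c) x) : nc_scope.
Notation "x - y" := (NCadd x (NCmul (NCcst (-1)) y)) : nc_scope.
Notation "0" := (NCcst 0) : nc_scope.
Notation "1" := (NCcst 1) : nc_scope.

Section Presentation.
Variables (F : fieldType) (I : Type).
Local Notation expr := (ncexpr F I).
Variable rel : expr -> expr -> Prop.

(* The smallest congruence that contains the relations and makes the quotient
   a unital associative F-algebra. *)
Inductive nccong : expr -> expr -> Prop :=
| nc_rel t u : rel t u -> nccong t u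
| nc_refl t : nccong t t
| nc_sym t u : nccong t u -> nccong u t
| nc_trans t u v : nccong t u -> nccong u v -> nccong t v
| nc_congD t t' u u' : nccong t t' -> nccong u u' -> nccong (t + u) (t' + u')
| nc_congM t t' u u' : nccong t t' -> nccong u u' -> nccong (t * u) (t' * u')
| nc_addA t u v : nccong (t + (u + v)) (t + u + v)
| nc_addC t u : nccong (t + u) (u + t)
| nc_add0 t : nccong (0 + t) t
| nc_addN t : nccong (t - t) 0
| nc_mulA t u v : nccong (t * (u * v)) (t * u * v)
| nc_mul1 t : nccong (1 * t) t
| nc_mulDl t u v : nccong ((t + u) * v) (t * v + u * v)
| nc_mulDr t u v : nccong (t * (u + v)) (t * u + t * v)
| nc_cstD a b : nccong (NCcst (a + b)) (NCcst a + NCcst b)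
| nc_cstM a b : nccong (NCcst (a * b)) (NCcst a * NCcst b)
| nc_cstC a t : nccong (NCcst a * t) (t * NCcst a).

HB.instance Definition _ := gen_eqMixin expr.
HB.instance Definition _ := gen_choiceMixin expr.

Definition nccongb (t u : expr) := `[< nccong t u >].

Lemma nccongb_equiv : equiv_class_of nccongb.
Proof.
split=> [t|t u|u t v].
- exact/asboolP/nc_refl.
- by apply/asboolP/asboolP; apply: nc_sym.
- by move=> /asboolP tu /asboolP uv; apply/asboolP/(nc_trans tu).
Qed.

Canonical nccong_equivRel := EquivRelPack nccongb_equiv.

Definition presented := {eq_quot nccong_equivRel}.
HB.instance Definition _ := Choice.on presented.

Definition pclass (t : expr) : presented := \pi_({eq_quot nccong_equivRel}) t.
Definition prepr (x : presented) : expr :=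
  repr (x : {eq_quot nccong_equivRel}).

Lemma preprK x : pclass (prepr x) = x.
Proof. exact: reprK. Qed.

Lemma pclassP t u : pclass t = pclass u <-> nccong t u.
Proof.
split=> [/eqmodP/asboolP //|tu].
by apply/eqmodP/asboolP.
Qed.

Lemma nccong_repr t : nccong (prepr (pclass t)) t.
Proof. by apply/pclassP; rewrite preprK. Qed.

Lemma pclass_surj (x : presented) : exists t, x = pclass t.
Proof. by exists (prepr x); rewrite preprK. Qed.

Definition padd (x y : presented) := pclass (prepr x + prepr y)%nc.
Definition pmul (x y : presented) := pclass (prepr x * prepr y)%nc.
Definition pscale (c : F) (x : presented) := pclass (c *: prepr x)%nc.
Definition popp (x : presented) := pscale (-1) x.

Lemma paddE t u : padd (pclass t) (pclass u) = pclass (t + u)%nc.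
Proof. by apply/pclassP/nc_congD; apply: nccong_repr. Qed.

Lemma pmulE t u : pmul (pclass t) (pclass u) = pclass (t * u)%nc.
Proof. by apply/pclassP/nc_congM; apply: nccong_repr. Qed.

Lemma pscaleE c t : pscale c (pclass t) = pclass (c *: t)%nc.
Proof. by apply/pclassP/nc_congM; [exact: nc_refl|exact: nccong_repr]. Qed.

Lemma paddA : associative padd.
Proof.
move=> x y z; have [t ->] := pclass_surj x; have [u ->] := pclass_surj y.
have [v ->] := pclass_surj z; rewrite !paddE; exact/pclassP/nc_addA.
Qed.

Lemma paddC : commutative padd.
Proof.
move=> x y; have [t ->] := pclass_surj x; have [u ->] := pclass_surj y.
rewrite !paddE; exact/pclassP/nc_addC.
Qed.

Lemma padd0 : left_id (pclass 0) padd.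
Proof.
by move=> x; have [t ->] := pclass_surj x; rewrite paddE; apply/pclassP/nc_add0.
Qed.

Lemma paddN : left_inverse (pclass 0) popp padd.
Proof.
move=> x; rewrite paddC; have [t ->] := pclass_surj x.
by rewrite /popp pscaleE paddE; apply/pclassP/nc_addN.
Qed.

HB.instance Definition _ := GRing.isZmodule.Build presented
  paddA paddC padd0 paddN.

Lemma pmulA : associative pmul.
Proof.
move=> x y z; have [t ->] := pclass_surj x; have [u ->] := pclass_surj y.
have [v ->] := pclass_surj z; rewrite !pmulE; exact/pclassP/nc_mulA.
Qed.

Lemma pmul1l : left_id (pclass 1) pmul.
Proof.
by move=> x; have [t ->] := pclass_surj x; rewrite pmulE; apply/pclassP/nc_mul1.
Qed.

Lemma pmul1r : right_id (pclass 1) pmul.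
Proof.
move=> x; have [t ->] := pclass_surj x; rewrite pmulE; apply/pclassP.
exact: nc_trans (nc_sym (nc_cstC _ _)) (nc_mul1 _).
Qed.

Lemma pmulDl : left_distributive pmul padd.
Proof.
move=> x y z; have [t ->] := pclass_surj x; have [u ->] := pclass_surj y.
by have [v ->] := pclass_surj z; rewrite paddE !pmulE paddE; apply/pclassP/nc_mulDl.
Qed.

Lemma pmulDr : right_distributive pmul padd.
Proof.
move=> x y z; have [t ->] := pclass_surj x; have [u ->] := pclass_surj y.
by have [v ->] := pclass_surj z; rewrite paddE !pmulE paddE; apply/pclassP/nc_mulDr.
Qed.

HB.instance Definition _ := GRing.Zmodule_isPzRing.Build presented
  pmulA pmul1l pmul1r pmulDl pmulDr.

Lemma pclassD t u : pclass (t + u)%nc = pclass t + pclass u.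
Proof. by rewrite -paddE. Qed.

Lemma pclassM t u : pclass (t * u)%nc = pclass t * pclass u.
Proof. by rewrite -pmulE. Qed.

Lemma pclass1 : pclass 1 = 1. Proof. by []. Qed.
Lemma pclass0 : pclass 0 = 0. Proof. by []. Qed.

Lemma pscaleM c x : pscale c x = pclass (NCcst c) * x.
Proof. by have [t ->] := pclass_surj x; rewrite pscaleE pclassM. Qed.

Lemma pcstM a b : pclass (NCcst (a * b)) = pclass (NCcst a) * pclass (NCcst b).
Proof. by rewrite -pclassM; apply/pclassP/nc_cstM. Qed.

Lemma pcstD a b : pclass (NCcst (a + b)) = pclass (NCcst a) + pclass (NCcst b).
Proof. by rewrite -pclassD; apply/pclassP/nc_cstD. Qed.

Lemma pcstC a x : pclass (NCcst a) * x = x * pclass (NCcst a).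
Proof.
by have [t ->] := pclass_surj x; rewrite -!pclassM; apply/pclassP/nc_cstC.
Qed.

Lemma pscaleA a b x : pscale a (pscale b x) = pscale (a * b) x.
Proof. by rewrite !pscaleM pcstM mulrA. Qed.

Lemma pscale1 : left_id 1 pscale.
Proof. by move=> x; rewrite pscaleM pclass1 mul1r. Qed.

Lemma pscaleDr : right_distributive pscale +%R.
Proof. by move=> a x y; rewrite !pscaleM mulrDr. Qed.

Lemma pscaleDl x : {morph pscale^~ x : a b / a + b}.
Proof. by move=> a b; rewrite !pscaleM pcstD mulrDl. Qed.

HB.instance Definition _ := GRing.Zmodule_isLmodule.Build F presented
  pscaleA pscale1 pscaleDr pscaleDl.

Lemma pscalerAl (a : F) (x y : presented) : a *: (x * y) = (a *: x) * y.
Proof. by rewrite /GRing.scale /= !pscaleM mulrA. Qed.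

Lemma pscalerAr (a : F) (x y : presented) : a *: (x * y) = x * (a *: y).
Proof. by rewrite /GRing.scale /= !pscaleM mulrA pcstC -!mulrA pcstC. Qed.

Lemma pclassZ c t : pclass (c *: t)%nc = c *: pclass t.
Proof. by rewrite pclassM -pscaleM. Qed.

Definition pgen (i : I) : presented := pclass (NCgen i).

(* Evaluation of expressions in a ring T, the constants being interpreted
   through a map eta : F -> T (the structure map of the F-algebra T). *)
Fixpoint nceval (T : pzRingType) (eta : F -> T) (v : I -> T) (t : expr) : T :=
  match t with
  | NCgen i => v i
  | NCcst c => eta c
  | NCadd t u => nceval eta v t + nceval eta v u
  | NCmul t u => nceval eta v t * nceval eta v u
  end.

Definition plift (T : pzRingType) (eta : F -> T) (v : I -> T) (x : presented) :=
  nceval eta v (prepr x).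

Section Universal.
Variables (T : pzRingType) (eta : {rmorphism F -> T}) (v : I -> T).
Hypothesis etaC : forall c x, eta c * x = x * eta c.
Hypothesis relv : forall t u, rel t u -> nceval eta v t = nceval eta v u.

Lemma nceval_cong t u : nccong t u -> nceval eta v t = nceval eta v u.
Proof.
elim=> {t u} /=.
- exact: relv.
- by [].
- by [].
- by move=> t u w _ -> _ ->.
- by move=> t t' u u' _ -> _ ->.
- by move=> t t' u u' _ -> _ ->.
- by move=> t u w; rewrite addrA.
- by move=> t u; rewrite addrC.
- by move=> t; rewrite rmorph0 add0r.
- by move=> t; rewrite rmorph0 rmorphN1 mulN1r subrr.
- by move=> t u w; rewrite mulrA.
- by move=> t; rewrite rmorph1 mul1r.
- by move=> t u w; rewrite mulrDl.
- by move=> t u w; rewrite mulrDr.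
- by move=> a b; rewrite rmorphD.
- by move=> a b; rewrite rmorphM.
- by move=> a t; rewrite etaC.
Qed.

Lemma plift_class t : plift eta v (pclass t) = nceval eta v t.
Proof. exact/nceval_cong/nccong_repr. Qed.

Lemma plift_gen i : plift eta v (pgen i) = v i.
Proof. exact: plift_class. Qed.

Lemma pliftD : {morph plift eta v : x y / x + y}.
Proof.
move=> x y; have [t ->] := pclass_surj x; have [u ->] := pclass_surj y.
by rewrite -pclassD !plift_class.
Qed.

Lemma pliftM : {morph plift eta v : x y / x * y}.
Proof.
move=> x y; have [t ->] := pclass_surj x; have [u ->] := pclass_surj y.
by rewrite -pclassM !plift_class.
Qed.

Lemma plift1 : plift eta v 1 = 1.
Proof. by rewrite -pclass1 plift_class /= rmorph1. Qed.

Lemma pliftZ c x : plift eta v (c *: x) = eta c * plift eta v x.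
Proof.
by have [t ->] := pclass_surj x; rewrite -pclassZ !plift_class.
Qed.

End Universal.
End Presentation.

Section Tensor.
Variables (F : fieldType) (A B : algType F).

Inductive texpr :=
| TPure of A & B
| TZero
| TAdd of texpr & texpr
| TScale of F & texpr.

Inductive tcong : texpr -> texpr -> Prop :=
| tc_refl t : tcong t t
| tc_sym t u : tcong t u -> tcong u t
| tc_trans t u v : tcong t u -> tcong u v -> tcong t v
| tc_congD t t' u u' :
    tcong t t' -> tcong u u' -> tcong (TAdd t u) (TAdd t' u')
| tc_congZ c t t' : tcong t t' -> tcong (TScale c t) (TScale c t')
| tc_addA t u v : tcong (TAdd t (TAdd u v)) (TAdd (TAdd t u) v)
| tc_addC t u : tcong (TAdd t u) (TAdd u t)
| tc_add0 t : tcong (TAdd TZero t) t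
| tc_addN t : tcong (TAdd (TScale (-1) t) t) TZero
| tc_scaleA a b t : tcong (TScale a (TScale b t)) (TScale (a * b) t)
| tc_scale1 t : tcong (TScale 1 t) t
| tc_scaleDr c t u : tcong (TScale c (TAdd t u)) (TAdd (TScale c t) (TScale c u))
| tc_scaleDl a b t : tcong (TScale (a + b) t) (TAdd (TScale a t) (TScale b t))
| tc_pureDl a a' b : tcong (TPure (a + a') b) (TAdd (TPure a b) (TPure a' b))
| tc_pureDr a b b' : tcong (TPure a (b + b')) (TAdd (TPure a b) (TPure a b'))
| tc_pureZl c a b : tcong (TPure (c *: a) b) (TScale c (TPure a b))
| tc_pureZr c a b : tcong (TPure a (c *: b)) (TScale c (TPure a b)).

HB.instance Definition _ := gen_eqMixin texpr.
HB.instance Definition _ := gen_choiceMixin texpr.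

Definition tcongb (t u : texpr) := `[< tcong t u >].

Lemma tcongb_equiv : equiv_class_of tcongb.
Proof.
split=> [t|t u|u t v].
- exact/asboolP/tc_refl.
- by apply/asboolP/asboolP; apply: tc_sym.
- by move=> /asboolP tu /asboolP uv; apply/asboolP/(tc_trans tu).
Qed.

Canonical tcong_equivRel := EquivRelPack tcongb_equiv.

Definition tensor := {eq_quot tcong_equivRel}.
HB.instance Definition _ := Choice.on tensor.

Definition tclass (t : texpr) : tensor := \pi_({eq_quot tcong_equivRel}) t.
Definition trepr (x : tensor) : texpr := repr (x : {eq_quot tcong_equivRel}).

Definition tpure (a : A) (b : B) : tensor := tclass (TPure a b).

Lemma treprK x : tclass (trepr x) = x.
Proof. exact: reprK. Qed.

Lemma tclassP t u : tclass t = tclass u <-> tcong t u.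
Proof.
split=> [/eqmodP/asboolP //|tu].
by apply/eqmodP/asboolP.
Qed.

Lemma tcong_repr t : tcong (trepr (tclass t)) t.
Proof. by apply/tclassP; rewrite treprK. Qed.

Lemma tclass_surj (x : tensor) : exists t, x = tclass t.
Proof. by exists (trepr x); rewrite treprK. Qed.

Definition tadd (x y : tensor) := tclass (TAdd (trepr x) (trepr y)).
Definition tscale (c : F) (x : tensor) := tclass (TScale c (trepr x)).
Definition topp (x : tensor) := tscale (-1) x.

Lemma taddE t u : tadd (tclass t) (tclass u) = tclass (TAdd t u).
Proof. by apply/tclassP/tc_congD; apply: tcong_repr. Qed.

Lemma tscaleE c t : tscale c (tclass t) = tclass (TScale c t).
Proof. by apply/tclassP/tc_congZ; apply: tcong_repr. Qed.

Lemma taddA : associative tadd.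
Proof.
move=> x y z; have [t ->] := tclass_surj x; have [u ->] := tclass_surj y.
have [v ->] := tclass_surj z; rewrite !taddE; exact/tclassP/tc_addA.
Qed.

Lemma taddC : commutative tadd.
Proof.
move=> x y; have [t ->] := tclass_surj x; have [u ->] := tclass_surj y.
rewrite !taddE; exact/tclassP/tc_addC.
Qed.

Lemma tadd0 : left_id (tclass TZero) tadd.
Proof.
by move=> x; have [t ->] := tclass_surj x; rewrite taddE; apply/tclassP/tc_add0.
Qed.

Lemma taddN : left_inverse (tclass TZero) topp tadd.
Proof.
move=> x; have [t ->] := tclass_surj x.
by rewrite /topp tscaleE taddE; apply/tclassP/tc_addN.
Qed.

HB.instance Definition _ := GRing.isZmodule.Build tensor taddA taddC tadd0 taddN.

Lemma tscaleA a b x : tscale a (tscale b x) = tscale (a * b) x.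
Proof.
by have [t ->] := tclass_surj x; rewrite !tscaleE; apply/tclassP/tc_scaleA.
Qed.

Lemma tscale1 : left_id 1 tscale.
Proof.
by move=> x; have [t ->] := tclass_surj x; rewrite tscaleE; apply/tclassP/tc_scale1.
Qed.

Lemma tscaleDr : right_distributive tscale +%R.
Proof.
move=> c x y; have [t ->] := tclass_surj x; have [u ->] := tclass_surj y.
rewrite /GRing.add /= taddE !tscaleE taddE; exact/tclassP/tc_scaleDr.
Qed.

Lemma tscaleDl x : {morph tscale^~ x : a b / a + b}.
Proof.
move=> a b; have [t ->] := tclass_surj x; rewrite !tscaleE.
by rewrite {2}/GRing.add /= taddE; apply/tclassP/tc_scaleDl.
Qed.

HB.instance Definition _ := GRing.Zmodule_isLmodule.Build F tensor
  tscaleA tscale1 tscaleDr tscaleDl.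

Lemma tclassD t u : tclass (TAdd t u) = tclass t + tclass u.
Proof. by rewrite -taddE. Qed.

Lemma tclassZ c t : tclass (TScale c t) = c *: tclass t.
Proof. by rewrite -tscaleE. Qed.

Lemma tclass0 : tclass TZero = 0. Proof. by []. Qed.

Lemma tpureDl a a' b : tpure (a + a') b = tpure a b + tpure a' b.
Proof. by rewrite -tclassD; apply/tclassP/tc_pureDl. Qed.

Lemma tpureDr a b b' : tpure a (b + b') = tpure a b + tpure a b'.
Proof. by rewrite -tclassD; apply/tclassP/tc_pureDr. Qed.

Lemma tpureZl c a b : tpure (c *: a) b = c *: tpure a b.
Proof. by rewrite -tclassZ; apply/tclassP/tc_pureZl. Qed.

Lemma tpureZr c a b : tpure a (c *: b) = c *: tpure a b.
Proof. by rewrite -tclassZ; apply/tclassP/tc_pureZr. Qed.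

Lemma tpureNl a b : tpure (- a) b = - tpure a b.
Proof. by rewrite -scaleN1r tpureZl scaleN1r. Qed.

Lemma tpureNr a b : tpure a (- b) = - tpure a b.
Proof. by rewrite -scaleN1r tpureZr scaleN1r. Qed.

Lemma tpure0l b : tpure 0 b = 0.
Proof. by rewrite -(scale0r 0) tpureZl scale0r. Qed.

Lemma tpure0r a : tpure a 0 = 0.
Proof. by rewrite -(scale0r 0) tpureZr scale0r. Qed.

Lemma tensor_ind (P : tensor -> Prop) :
  P 0 -> (forall a b, P (tpure a b)) -> (forall x y, P x -> P y -> P (x + y)) ->
  (forall c x, P x -> P (c *: x)) -> forall x, P x.
Proof.
move=> P0 Pp PD PZ x; have [t ->] := tclass_surj x.
elim: t => [a b||t IHt u IHu|c t IHt].
- exact: Pp.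
- exact: P0.
- by rewrite tclassD; apply: PD.
- by rewrite tclassZ; apply: PZ.
Qed.

Lemma tensor_sum (x : tensor) :
  exists l : seq (A * B), x = \sum_(p <- l) tpure p.1 p.2.
Proof.
elim/tensor_ind: x => [|a b|x y [l ->] [l' ->]|c x [l ->]].
- by exists [::]; rewrite big_nil.
- by exists [:: (a, b)]; rewrite big_seq1.
- by exists (l ++ l'); rewrite big_cat.
- exists [seq (c *: p.1, p.2) | p <- l]; rewrite big_map scaler_sumr.
  by apply: eq_bigr => p _ /=; rewrite tpureZl.
Qed.

Fixpoint teval (V : lmodType F) (beta : A -> B -> V) (t : texpr) : V :=
  match t with
  | TPure a b => beta a b
  | TZero => 0
  | TAdd t u => teval beta t + teval beta u
  | TScale c t => c *: teval beta t
  end.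

Definition tlift (V : lmodType F) (beta : A -> B -> V) (x : tensor) : V :=
  teval beta (trepr x).

Lemma teval_lin (V : lmodType F) c (beta beta1 beta2 : A -> B -> V) t :
  (forall a b, beta a b = c *: beta1 a b + beta2 a b) ->
  teval beta t = c *: teval beta1 t + teval beta2 t.
Proof.
move=> h; elim: t => [a b||t IHt u IHu|d t IHt] /=.
- exact: h.
- by rewrite scaler0 addr0.
- by rewrite IHt IHu scalerDr addrACA.
- by rewrite IHt scalerDr !scalerA mulrC.
Qed.

Section Lift.
Variables (V : lmodType F) (beta : A -> B -> V).
Hypothesis betal : forall b, linear (beta^~ b).
Hypothesis betar : forall a, linear (beta a).

Lemma teval_cong t u : tcong t u -> teval beta t = teval beta u.
Proof.
have betaD1 a a' b : beta (a + a') b = beta a b + beta a' b.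
  by have := betal b 1 a a'; rewrite !scale1r.
have betaD2 a b b' : beta a (b + b') = beta a b + beta a b'.
  by have := betar a 1 b b'; rewrite !scale1r.
have beta0 b : beta 0 b = 0.
  by apply: (addrI (beta 0 b)); rewrite -betaD1 !addr0.
have beta0' a : beta a 0 = 0.
  by apply: (addrI (beta a 0)); rewrite -betaD2 !addr0.
elim=> {t u} /=.
- by [].
- by [].
- by move=> t u w _ -> _ ->.
- by move=> t t' u u' _ -> _ ->.
- by move=> c t t' _ ->.
- by move=> t u w; rewrite addrA.
- by move=> t u; rewrite addrC.
- by move=> t; rewrite add0r.
- by move=> t; rewrite scaleN1r addNr.
- by move=> a b t; rewrite scalerA.
- by move=> t; rewrite scale1r.
- by move=> c t u; rewrite scalerDr.
- by move=> a b t; rewrite scalerDl.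
- exact: betaD1.
- exact: betaD2.
- by move=> c a b; have := betal b c a 0; rewrite /= beta0 !addr0.
- by move=> c a b; have := betar a c b 0; rewrite beta0' !addr0.
Qed.

Lemma tlift_class t : tlift beta (tclass t) = teval beta t.
Proof. exact/teval_cong/tcong_repr. Qed.

Lemma tlift_pure a b : tlift beta (tpure a b) = beta a b.
Proof. exact: tlift_class. Qed.

Lemma tlift_linear : linear (tlift beta).
Proof.
move=> c x y; have [t ->] := tclass_surj x; have [u ->] := tclass_surj y.
by rewrite -tclassZ -tclassD !tlift_class.
Qed.

End Lift.

(* (a (x) b) (a' (x) b') = a a' (x) b b' *)
Definition tmul (x y : tensor) : tensor :=
  tlift (fun a b => tlift (fun a' b' => tpure (a * a') (b * b')) y) x.

Lemma tpure_mul_linl a b b' : linear (fun a' => tpure (a * a') (b * b')).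
Proof. by move=> c x y; rewrite mulrDr -scalerAr tpureDl tpureZl. Qed.

Lemma tpure_mul_linr a b a' : linear (fun b' => tpure (a * a') (b * b')).
Proof. by move=> c x y; rewrite mulrDr -scalerAr tpureDr tpureZr. Qed.

Let inner a b := @tlift _ (fun a' b' => tpure (a * a') (b * b')).

Let inner_linear a b : linear (inner a b).
Proof.
by apply: tlift_linear => ?; [apply: tpure_mul_linl|apply: tpure_mul_linr].
Qed.

Let outerl y b : linear (fun a => inner a b y).
Proof.
move=> c x x'; apply: teval_lin => a' b'.
by rewrite mulrDl -scalerAl tpureDl tpureZl.
Qed.

Let outerr y a : linear (fun b => inner a b y).
Proof.
move=> c x x'; apply: teval_lin => a' b'.
by rewrite mulrDl -scalerAl tpureDr tpureZr.
Qed.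

Lemma tmul_linearl y : linear (tmul^~ y).
Proof. by apply: tlift_linear => ?; [apply: outerl|apply: outerr]. Qed.

Lemma tmul_linearr x : linear (tmul x).
Proof. by move=> c y y'; apply: teval_lin => a b; apply: inner_linear. Qed.

Lemma tmul_pure a b a' b' :
  tmul (tpure a b) (tpure a' b') = tpure (a * a') (b * b').
Proof.
rewrite /tmul tlift_pure => [|?|?]; [|exact: outerl|exact: outerr].
by rewrite tlift_pure => // ?; [apply: tpure_mul_linl|apply: tpure_mul_linr].
Qed.

Lemma tmulDl : left_distributive tmul +%R.
Proof. by move=> x y z; have := tmul_linearl z 1 x y; rewrite !scale1r. Qed.

Lemma tmulDr : right_distributive tmul +%R.
Proof. by move=> x y z; have := tmul_linearr x 1 y z; rewrite !scale1r. Qed.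

Lemma tmul0l x : tmul 0 x = 0.
Proof. by apply: (addrI (tmul 0 x)); rewrite -tmulDl !addr0. Qed.

Lemma tmul0r x : tmul x 0 = 0.
Proof. by apply: (addrI (tmul x 0)); rewrite -tmulDr !addr0. Qed.

Lemma tmulZl c x y : tmul (c *: x) y = c *: tmul x y.
Proof. by have := tmul_linearl y c x 0; rewrite /= tmul0l !addr0. Qed.

Lemma tmulZr c x y : tmul x (c *: y) = c *: tmul x y.
Proof. by have := tmul_linearr x c y 0; rewrite tmul0r !addr0. Qed.

Lemma tmulA : associative tmul.
Proof.
move=> x y z; elim/tensor_ind: x => [|a b|x x' hx hx'|c x hx].
- by rewrite !tmul0l.
- elim/tensor_ind: y => [|a' b'|y y' hy hy'|c y hy].
  + by rewrite tmul0l !tmul0r tmul0l.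
  + elim/tensor_ind: z => [|a2 b2|z z' hz hz'|c z hz].
    * by rewrite !tmul0r.
    * by rewrite !tmul_pure !mulrA.
    * by rewrite !tmulDr hz hz'.
    * by rewrite !tmulZr hz.
  + by rewrite tmulDl !tmulDr tmulDl hy hy'.
  + by rewrite tmulZl !tmulZr tmulZl hy.
- by rewrite !tmulDl hx hx'.
- by rewrite !tmulZl hx.
Qed.

Lemma tmul1l : left_id (tpure 1 1) tmul.
Proof.
elim/tensor_ind=> [|a b|x x' hx hx'|c x hx].
- by rewrite tmul0r.
- by rewrite tmul_pure !mul1r.
- by rewrite tmulDr hx hx'.
- by rewrite tmulZr hx.
Qed.

Lemma tmul1r : right_id (tpure 1 1) tmul.
Proof.
elim/tensor_ind=> [|a b|x x' hx hx'|c x hx].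
- by rewrite tmul0l.
- by rewrite tmul_pure !mulr1.
- by rewrite tmulDl hx hx'.
- by rewrite tmulZl hx.
Qed.

HB.instance Definition _ := GRing.Zmodule_isPzRing.Build tensor
  tmulA tmul1l tmul1r tmulDl tmulDr.

Lemma tpureM a b a' b' : tpure a b * tpure a' b' = tpure (a * a') (b * b').
Proof. exact: tmul_pure. Qed.

Lemma tpure11 : tpure 1 1 = 1. Proof. by []. Qed.

Lemma tscalerAl c (x y : tensor) : c *: (x * y) = (c *: x) * y.
Proof. by rewrite [RHS]tmulZl. Qed.

Lemma tscalerAr c (x y : tensor) : c *: (x * y) = x * (c *: y).
Proof. by rewrite [RHS]tmulZr. Qed.

Definition tin_alg (c : F) : tensor := c *: (1 : tensor).

Lemma tin_alg_additive : zmod_morphism tin_alg.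
Proof. by move=> c d; rewrite /tin_alg scalerBl. Qed.

Lemma tin_alg_monoid : monoid_morphism tin_alg.
Proof.
split=> [|c d]; first by rewrite /tin_alg scale1r.
by rewrite /tin_alg -tscalerAl mul1r scalerA.
Qed.

HB.instance Definition _ :=
  GRing.isZmodMorphism.Build F tensor tin_alg tin_alg_additive.
HB.instance Definition _ :=
  GRing.isMonoidMorphism.Build F tensor tin_alg tin_alg_monoid.

Lemma tin_algE c x : tin_alg c * x = c *: x.
Proof. by rewrite -tscalerAl mul1r. Qed.

Lemma tin_algC c x : tin_alg c * x = x * tin_alg c.
Proof. by rewrite -tscalerAl -tscalerAr mul1r mulr1. Qed.

End Tensor.

Section TensorSerre.
Variables (F : fieldType) (A B : algType F).
Local Notation T := (tensor A B).
Implicit Types X Y : T.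

Definition serre (s : F) X Y Z : T := X * Y * Z - s *: (X * Z * Y) + Z * X * Y.

Lemma serreDl s X X' Y Z : serre s (X + X') Y Z = serre s X Y Z + serre s X' Y Z.
Proof. by rewrite /serre !(mulrDl, mulrDr, scalerDr, opprD) [X in X + _ = _]addrACA [LHS]addrACA. Qed.

Lemma serreDm s X Y Y' Z : serre s X (Y + Y') Z = serre s X Y Z + serre s X Y' Z.
Proof. by rewrite /serre !(mulrDl, mulrDr, scalerDr, opprD) [X in X + _ = _]addrACA [LHS]addrACA. Qed.

Lemma serreDr s X Y Z Z' : serre s X Y (Z + Z') = serre s X Y Z + serre s X Y Z'.
Proof. by rewrite /serre !(mulrDl, mulrDr, scalerDr, opprD) [X in X + _ = _]addrACA [LHS]addrACA. Qed.

Lemma serre_add (q : F) X Y X' Y' : q != 0 ->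
  Y * X = q ^+ 2 *: (X * Y) -> Y * X' = q^-1 *: (X' * Y) ->
  Y' * X = q^-1 *: (X * Y') ->
  serre (q + q^-1) X X X' = 0 -> serre (q + q^-1) Y Y Y' = 0 ->
  serre (q + q^-1) (X + Y) (X + Y) (X' + Y') = 0.
Proof.
move=> q0 YX YX' Y'X hX hY; set s := q + q^-1 in hX hY *.
have XXY' : serre s X X Y' = 0.
  rewrite /serre -!mulrA Y'X -!tscalerAr [Y' * (X * X)]mulrA Y'X -!tscalerAl.
  rewrite -[X * Y' * X]mulrA Y'X -!tscalerAr !scalerA -scaleNr -{1}[X * (X * Y')]scale1r.
  rewrite -!scalerDl -[RHS](scale0r (X * (X * Y'))).
  by congr (_ *: _); rewrite /s; field.
have YYX' : serre s Y Y X' = 0.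
  rewrite /serre -!mulrA YX' -!tscalerAr [Y * (X' * Y)]mulrA YX' -!tscalerAl.
  rewrite -[X' * Y * Y]mulrA !scalerA -scaleNr.
  rewrite -{3}[X' * (Y * Y)]scale1r.
  rewrite -!scalerDl -[RHS](scale0r (X' * (Y * Y))).
  by congr (_ *: _); rewrite /s; field.
have XYX' : serre s X Y X' + serre s Y X X' = 0.
  have e1 : serre s X Y X' = (q^-1 - s) *: (X * X' * Y) + X' * X * Y.
    rewrite /serre -(mulrA X Y) YX' -tscalerAr mulrA.
    by rewrite -scaleNr -scalerDl.
  have e2 : serre s Y X X' = q *: (X * X' * Y) - X' * X * Y.
    rewrite /serre YX -!tscalerAl -(mulrA X Y) YX' -!tscalerAl -!tscalerAr.
    rewrite -!(mulrA X' Y) YX -!tscalerAr !scalerA [q ^+ 2 / q](_ : _ = q); last by field.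
    rewrite !mulrA -addrA -scaleNr -scalerDl -scaleN1r; congr (_ + _ *: _).
    by rewrite /s; field.
  rewrite e1 e2 addrACA subrr addr0 -scalerDl.
  by rewrite -[RHS](scale0r (X * X' * Y)); congr (_ *: _); rewrite /s; ring.
have XYY' : serre s X Y Y' + serre s Y X Y' = 0.
  have e1 : serre s X Y Y' = X * Y * Y' - q *: (X * Y' * Y).
    rewrite /serre Y'X -!tscalerAl -addrA -scaleNr -scalerDl -scaleNr.
    by congr (_ + _ *: _); rewrite /s; ring.
  have e2 : serre s Y X Y' = - (X * Y * Y') + q *: (X * Y' * Y).
    rewrite /serre YX -!tscalerAl -(mulrA Y Y') Y'X -tscalerAr mulrA YX.
    rewrite -(mulrA Y' Y) YX -tscalerAr mulrA Y'X -!tscalerAl !scalerA.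
    rewrite -scaleNr -scalerDl -scaleN1r.
    by congr (_ *: _ + _ *: _); rewrite /s; field.
  by rewrite e1 e2 addrACA subrr addNr addr0.
rewrite !serreDl !serreDm !serreDr hX hY XXY' YYX' !addr0 !add0r.
by rewrite addrACA XYX' XYY' addr0.
Qed.

End TensorSerre.

Notation "x '\ot' y" := (tpure x y) (at level 40, left associativity).

Inductive qspace_rel (F : fieldType) (n : nat) (q : F) :
  ncexpr F 'I_n -> ncexpr F 'I_n -> Prop :=
| qspace_comm (i j : 'I_n) : (j < i)%N ->
    qspace_rel q (NCgen i * NCgen j) (q *: (NCgen j * NCgen i)).

Definition qspace (F : fieldType) (n : nat) (q : F) := presented (@qspace_rel F n q).

Section QuantumSpace.
Variables (F : fieldType) (n : nat) (q : F).

HB.instance Definition _ := GRing.Lmodule.on (qspace n q).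
HB.instance Definition _ := GRing.PzRing.on (qspace n q).

Lemma qspace_neq0 : (1 : qspace n q) != 0.
Proof.
apply/eqP => /(congr1 (plift idfun (fun=> 0))).
have relv t u : @qspace_rel F n q t u ->
    nceval idfun (fun=> 0) t = nceval idfun (fun=> 0) u.
  by case=> i j _ /=; rewrite !mul0r mulr0.
rewrite (plift1 _ relv) => [|c x]; last exact: mulrC.
rewrite -pclass0 plift_class => [/eqP|c x|]; [by rewrite oner_eq0|exact: mulrC|].
exact: relv.
Qed.

HB.instance Definition _ :=
  GRing.PzSemiRing_isNonZero.Build (qspace n q) qspace_neq0.
HB.instance Definition _ :=
  GRing.Lmodule_isLalgebra.Build F (qspace n q) (@pscalerAl F _ _).
HB.instance Definition _ :=
  GRing.Lalgebra_isAlgebra.Build F (qspace n q) (@pscalerAr F _ _).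

(* The generators are numbered from 1 to n; qx i is 0 for i out of range. *)
Definition qx (i : nat) : qspace n q :=
  if i is i'.+1 then oapp (pgen (@qspace_rel F n q)) 0 (insub i') else 0.

End QuantumSpace.

Definition cartan (i j : nat) : int :=
  if i == j then 2 else if (i == j.+1) || (j == i.+1) then -1 else 0.

Inductive uqgen (m : nat) :=
| UqE of 'I_m
| UqF of 'I_m
| UqK of 'I_m
| UqKV of 'I_m.

Section UqDef.
Variables (F : fieldType) (m : nat) (q : F).
Local Notation expr := (ncexpr F (uqgen m)).
Local Notation e i := (NCgen (UqE i) : expr).
Local Notation f i := (NCgen (UqF i) : expr).
Local Notation k i := (NCgen (UqK i) : expr).
Local Notation k' i := (NCgen (UqKV i) : expr).

Inductive uq_rel : expr -> expr -> Prop :=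
| uq_kk' (i : 'I_m) : uq_rel (k i * k' i) 1
| uq_k'k (i : 'I_m) : uq_rel (k' i * k i) 1
| uq_kk (i j : 'I_m) : uq_rel (k i * k j) (k j * k i)
| uq_ke (i j : 'I_m) : uq_rel (k i * e j * k' i) (q ^ cartan i j *: e j)
| uq_kf (i j : 'I_m) : uq_rel (k i * f j * k' i) (q ^ (- cartan i j) *: f j)
| uq_ef_diag (i : 'I_m) : uq_rel (e i * f i - f i * e i) ((q - q^-1)^-1 *: (k i - k' i))
| uq_ef (i j : 'I_m) : i != j -> uq_rel (e i * f j - f j * e i) 0
| uq_ee (i j : 'I_m) : cartan i j = 0 -> uq_rel (e i * e j) (e j * e i)
| uq_ff (i j : 'I_m) : cartan i j = 0 -> uq_rel (f i * f j) (f j * f i)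
| uq_serre_e (i j : 'I_m) : cartan i j = -1 ->
    uq_rel (e i * e i * e j - (q + q^-1) *: (e i * e j * e i) + e j * e i * e i) 0
| uq_serre_f (i j : 'I_m) : cartan i j = -1 ->
    uq_rel (f i * f i * f j - (q + q^-1) *: (f i * f j * f i) + f j * f i * f i) 0.

Definition Uq := presented uq_rel.
HB.instance Definition _ := GRing.Lmodule.on Uq.
HB.instance Definition _ := GRing.PzRing.on Uq.

Definition uqe i : Uq := pgen uq_rel (UqE i).
Definition uqf i : Uq := pgen uq_rel (UqF i).
Definition uqk i : Uq := pgen uq_rel (UqK i).
Definition uqkV i : Uq := pgen uq_rel (UqKV i).

Definition uq_counit_gen (x : uqgen m) : F :=
  match x with UqE _ | UqF _ => 0 | UqK _ | UqKV _ => 1 end.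

Definition uq_counit (x : Uq) : F^o := plift idfun uq_counit_gen x.

Lemma uq_counit_rel t u : uq_rel t u ->
  nceval idfun uq_counit_gen t = nceval idfun uq_counit_gen u.
Proof.
by case=> * /=; rewrite ?(mulr0, mul0r, mulr1, mul1r, addr0, mulN1r, subrr).
Qed.

Let idC (c x : F) : (idfun : {rmorphism F -> F}) c * x = x * idfun c.
Proof. exact: mulrC. Qed.

Lemma uq_counit_linear : linear uq_counit.
Proof.
move=> c x y; rewrite /uq_counit (pliftD idC uq_counit_rel).
by rewrite (pliftZ idC uq_counit_rel).
Qed.

Lemma uq_counit_monoid : monoid_morphism uq_counit.
Proof.
split; first exact: (plift1 idC uq_counit_rel).
exact: (pliftM idC uq_counit_rel).
Qed.

Lemma Uq_neq0 : (1 : Uq) != 0.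
Proof.
apply/eqP => /(congr1 uq_counit).
rewrite uq_counit_monoid.1 /uq_counit -pclass0.
by rewrite (plift_class idC uq_counit_rel) => /eqP; rewrite oner_eq0.
Qed.

HB.instance Definition _ := GRing.PzSemiRing_isNonZero.Build Uq Uq_neq0.
HB.instance Definition _ :=
  GRing.Lmodule_isLalgebra.Build F Uq (@pscalerAl F _ _).
HB.instance Definition _ :=
  GRing.Lalgebra_isAlgebra.Build F Uq (@pscalerAr F _ _).

HB.instance Definition _ :=
  GRing.isLinear.Build F Uq F^o *:%R uq_counit uq_counit_linear.
HB.instance Definition _ :=
  GRing.isMonoidMorphism.Build Uq F^o uq_counit uq_counit_monoid.

Definition uq_comul_gen (x : uqgen m) : tensor Uq Uq :=
  match x with
  | UqE i => 1 \ot uqe i + uqe i \ot uqk i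
  | UqF i => uqkV i \ot uqf i + uqf i \ot 1
  | UqK i => uqk i \ot uqk i
  | UqKV i => uqkV i \ot uqkV i
  end.

Definition uq_comul (x : Uq) : tensor Uq Uq :=
  plift (@tin_alg F Uq Uq) uq_comul_gen x.

Lemma uq_relE t u : uq_rel t u -> pclass uq_rel t = pclass uq_rel u.
Proof. by move=> tu; apply/pclassP/nc_rel. Qed.

Let simp := (pclassD, pclassZ, pclassM, (@scaleN1r F Uq), pclass1, pclass0).

Lemma uqkkV i : uqk i * uqkV i = 1.
Proof. by have := uq_relE (uq_kk' i); rewrite !simp. Qed.

Lemma uqkVk i : uqkV i * uqk i = 1.
Proof. by have := uq_relE (uq_k'k i); rewrite !simp. Qed.

Lemma uqkC (i j : 'I_m) : uqk i * uqk j = uqk j * uqk i.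
Proof. by have := uq_relE (uq_kk i j); rewrite !simp. Qed.

Lemma uqke (i j : 'I_m) : uqk i * uqe j = q ^ cartan i j *: (uqe j * uqk i).
Proof.
have := uq_relE (uq_ke i j); rewrite !simp => /(congr1 ( *%R^~ (uqk i))) /=.
by rewrite -[_ * pclass _ _ * uqk i]mulrA uqkVk mulr1 -scalerAl.
Qed.

Lemma uqkf (i j : 'I_m) : uqk i * uqf j = q ^ (- cartan i j) *: (uqf j * uqk i).
Proof.
have := uq_relE (uq_kf i j); rewrite !simp => /(congr1 ( *%R^~ (uqk i))) /=.
by rewrite -[_ * pclass _ _ * uqk i]mulrA uqkVk mulr1 -scalerAl.
Qed.

Lemma uqefD i :
  uqe i * uqf i - uqf i * uqe i = (q - q^-1)^-1 *: (uqk i - uqkV i).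
Proof. by have := uq_relE (uq_ef_diag i); rewrite !simp. Qed.

Lemma uqef (i j : 'I_m) : i != j -> uqe i * uqf j = uqf j * uqe i.
Proof. by move/uq_ef/uq_relE; rewrite !simp => /eqP; rewrite subr_eq0 => /eqP. Qed.

Lemma uqee (i j : 'I_m) : cartan i j = 0 -> uqe i * uqe j = uqe j * uqe i.
Proof. by move/uq_ee/uq_relE; rewrite !simp. Qed.

Lemma uqff (i j : 'I_m) : cartan i j = 0 -> uqf i * uqf j = uqf j * uqf i.
Proof. by move/uq_ff/uq_relE; rewrite !simp. Qed.

Lemma uqserre_e (i j : 'I_m) : cartan i j = -1 ->
  uqe i * uqe i * uqe j - (q + q^-1) *: (uqe i * uqe j * uqe i)
    + uqe j * uqe i * uqe i = 0.
Proof. by move/uq_serre_e/uq_relE; rewrite !simp. Qed.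

Lemma uqserre_f (i j : 'I_m) : cartan i j = -1 ->
  uqf i * uqf i * uqf j - (q + q^-1) *: (uqf i * uqf j * uqf i)
    + uqf j * uqf i * uqf i = 0.
Proof. by move/uq_serre_f/uq_relE; rewrite !simp. Qed.

Lemma uqkVC (i j : 'I_m) : uqkV i * uqkV j = uqkV j * uqkV i.
Proof.
have kkV : uqk j * uqkV i = uqkV i * uqk j.
  rewrite -[LHS]mul1r -(uqkVk i) -mulrA [uqk i * _]mulrA uqkC.
  by rewrite -[_ * uqk i * _]mulrA uqkkV mulr1.
rewrite -[LHS]mul1r -(uqkVk j) -mulrA [uqk j * _]mulrA kkV.
by rewrite -[_ * uqk j * _]mulrA uqkkV mulr1.
Qed.

Lemma uqkkVC (i j : 'I_m) : uqk i * uqkV j = uqkV j * uqk i.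
Proof.
rewrite -[LHS]mul1r -(uqkVk j) -mulrA [uqk j * _]mulrA uqkC.
by rewrite -[_ * uqk j * _]mulrA uqkkV mulr1.
Qed.

Lemma cartanC i j : cartan i j = cartan j i.
Proof. by rewrite /cartan eq_sym orbC. Qed.

Lemma uqe_q0 i : q = 0 -> uqe i = 0.
Proof.
move=> q0; have := uqke i i; rewrite q0 /cartan eqxx exprSz mul0r scale0r.
by move=> /(congr1 ( *%R (uqkV i))); rewrite mulrA uqkVk mul1r mulr0.
Qed.

Lemma uqf_q0 i : q = 0 -> uqf i = 0.
Proof.
move=> q0; have := uqkf i i; rewrite -invr_expz q0 /cartan eqxx exprSz mul0r.
rewrite invr0 scale0r.
by move=> /(congr1 ( *%R (uqkV i))); rewrite mulrA uqkVk mul1r mulr0.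
Qed.

Lemma uqkVe (i j : 'I_m) : q != 0 ->
  uqkV i * uqe j = q ^ (- cartan i j) *: (uqe j * uqkV i).
Proof.
move=> q0; have := congr1 (fun x => uqkV i * x * uqkV i) (uqke i j).
rewrite mulrA uqkVk mul1r -scalerAr -scalerAl => /(congr1 (GRing.scale (q ^ (- cartan i j)))) /=.
rewrite scalerA -expfzDr // addNr expr0z scale1r => ->.
by rewrite -!mulrA uqkkV mulr1.
Qed.

Lemma uqkVf (i j : 'I_m) : q != 0 ->
  uqkV i * uqf j = q ^ (cartan i j) *: (uqf j * uqkV i).
Proof.
move=> q0; have := congr1 (fun x => uqkV i * x * uqkV i) (uqkf i j).
rewrite mulrA uqkVk mul1r -scalerAr -scalerAl => /(congr1 (GRing.scale (q ^ (cartan i j)))) /=.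
rewrite scalerA -expfzDr // addrN expr0z scale1r => ->.
by rewrite -!mulrA uqkkV mulr1.
Qed.

Local Notation DE i := (1 \ot uqe i + uqe i \ot uqk i).
Local Notation DF i := (uqkV i \ot uqf i + uqf i \ot 1).
Local Notation DK i := (uqk i \ot uqk i).
Local Notation DKV i := (uqkV i \ot uqkV i).

Lemma uq_comul_ke (i j : 'I_m) : DK i * DE j * DKV i = q ^ cartan i j *: DE j.
Proof.
rewrite !(mulrDl, mulrDr) !tpureM !(mulr1, mul1r) uqkkV uqke uqkC.
rewrite -!scalerAl -!mulrA uqkkV !mulr1.
by rewrite tpureZl tpureZr scalerDr.
Qed.

Lemma uq_comul_kf (i j : 'I_m) : DK i * DF j * DKV i = q ^ (- cartan i j) *: DF j.
Proof.
rewrite !(mulrDl, mulrDr) !tpureM !(mulr1, mul1r) uqkkV uqkf uqkkVC.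
rewrite -!scalerAl -!mulrA uqkkV !mulr1.
by rewrite tpureZl tpureZr scalerDr.
Qed.

Lemma uq_comul_ef (i j : 'I_m) :
  DE i * DF j - DF j * DE i =
  uqkV j \ot (uqe i * uqf j - uqf j * uqe i)
    + (uqe i * uqf j - uqf j * uqe i) \ot uqk i.
Proof.
have cross : (uqe i * uqkV j) \ot (uqk i * uqf j)
           = (uqkV j * uqe i) \ot (uqf j * uqk i).
  have [q0|q0] := eqVneq q 0; first by rewrite !uqe_q0 ?(mul0r, mulr0) ?tpure0l.
  by rewrite uqkf uqkVe // cartanC tpureZl tpureZr.
rewrite !(mulrDl, mulrDr) !tpureM !(mulr1, mul1r) cross.
rewrite tpureDl tpureDr tpureNl tpureNr !opprD.
set a := _ \ot (uqe i * _); set b := uqf j \ot _; set c := (uqkV j * _) \ot _.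
set d := (uqe i * _) \ot _; set a' := _ \ot (uqf j * _).
set d' := (uqf j * _) \ot _.
rewrite [LHS](AC ((2*2)*(2*2)) ((1*5)*(4*8)*((3*6)*(2*7)))) /=.
by rewrite !subrr !addr0.
Qed.

Lemma uq_comul_ee (i j : 'I_m) : cartan i j = 0 -> DE i * DE j = DE j * DE i.
Proof.
move=> aij; rewrite !(mulrDl, mulrDr) !tpureM !(mulr1, mul1r).
rewrite uqee // (uqkC i j) !uqke (cartanC j i) aij expr0z !scale1r.
by rewrite (AC (2*2) ((1*3)*(2*4))).
Qed.

Lemma uq_comul_ff (i j : 'I_m) : cartan i j = 0 -> DF i * DF j = DF j * DF i.
Proof.
move=> aij; have [q0|q0] := eqVneq q 0.
  by rewrite !uqf_q0 // !(tpure0l, tpure0r) !addr0.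
rewrite !(mulrDl, mulrDr) !tpureM !(mulr1, mul1r).
rewrite uqff // (uqkVC i j) !uqkVf // (cartanC j i) aij expr0z !scale1r.
by rewrite (AC (2*2) ((1*3)*(2*4))).
Qed.

Lemma uq_comul_serre_e (i j : 'I_m) : cartan i j = -1 ->
  serre (q + q^-1) (DE i) (DE i) (DE j) = 0.
Proof.
move=> aij; have aji : cartan j i = -1 by rewrite cartanC.
have aii : cartan i i = 2 by rewrite /cartan eqxx.
have [q0|q0] := eqVneq q 0.
  rewrite !uqe_q0 // !(tpure0l, tpure0r) !addr0 /serre.
  by rewrite !(mulr0, mul0r) scaler0 subrr addr0.
apply: serre_add => //.
- by rewrite !tpureM !(mulr1, mul1r) uqke aii tpureZr.
- by rewrite !tpureM !(mulr1, mul1r) uqke aij tpureZr.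
- by rewrite !tpureM !(mulr1, mul1r) uqke aji tpureZr.
- rewrite /serre !tpureM !mulr1 -tpureZr -tpureNr -!tpureDr.
  by rewrite uqserre_e // tpure0r.
- have k1 : uqk i * uqk j * uqk i = uqk i * uqk i * uqk j.
    by rewrite -mulrA (uqkC j) mulrA.
  have k2 : uqk j * uqk i * uqk i = uqk i * uqk i * uqk j.
    by rewrite uqkC k1.
  rewrite /serre !tpureM k1 k2 -tpureZl -tpureNl -!tpureDl.
  by rewrite uqserre_e // tpure0l.
Qed.

Lemma uq_comul_serre_f (i j : 'I_m) : cartan i j = -1 ->
  serre (q + q^-1) (DF i) (DF i) (DF j) = 0.
Proof.
move=> aij; have aji : cartan j i = -1 by rewrite cartanC.
have aii : cartan i i = 2 by rewrite /cartan eqxx.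
have [q0|q0] := eqVneq q 0.
  rewrite !uqf_q0 // !(tpure0l, tpure0r) !addr0 /serre.
  by rewrite !(mulr0, mul0r) scaler0 subrr addr0.
rewrite ![uqkV _ \ot _ + _]addrC; apply: serre_add => //.
- by rewrite !tpureM !(mulr1, mul1r) uqkVf // aii tpureZl.
- by rewrite !tpureM !(mulr1, mul1r) uqkVf // aij tpureZl.
- by rewrite !tpureM !(mulr1, mul1r) uqkVf // aji tpureZl.
- rewrite /serre !tpureM !mulr1 -tpureZl -tpureNl -!tpureDl.
  by rewrite uqserre_f // tpure0l.
- have k1 : uqkV i * uqkV j * uqkV i = uqkV i * uqkV i * uqkV j.
    by rewrite -mulrA (uqkVC j) mulrA.
  have k2 : uqkV j * uqkV i * uqkV i = uqkV i * uqkV i * uqkV j.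
    by rewrite uqkVC k1.
  rewrite /serre !tpureM k1 k2 -tpureZr -tpureNr -!tpureDr.
  by rewrite uqserre_f // tpure0r.
Qed.

Lemma uq_comul_rel t u : uq_rel t u ->
  nceval (tin_alg Uq Uq) uq_comul_gen t = nceval (tin_alg Uq Uq) uq_comul_gen u.
Proof.
have algN1 (x : tensor Uq Uq) : tin_alg Uq Uq (-1) * x = - x.
  by rewrite tin_algE scaleN1r.
case=> [i|i|i j|i j|i j|i|i j ij|i j aij|i j aij|i j aij|i j aij] /=;
  rewrite ?algN1 ?tin_algE ?rmorph0.
- by rewrite tpureM uqkkV rmorph1.
- by rewrite tpureM uqkVk rmorph1.
- by rewrite !tpureM uqkC.
- exact: uq_comul_ke.
- exact: uq_comul_kf.
- rewrite uq_comul_ef uqefD tpureZl tpureZr -scalerDr.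
  by rewrite tpureDl tpureDr tpureNl tpureNr; congr (_ *: _); rewrite addrC addrA addrNK.
- by rewrite uq_comul_ef uqef // subrr tpure0l tpure0r addr0.
- exact: uq_comul_ee.
- exact: uq_comul_ff.
- exact: uq_comul_serre_e.
- exact: uq_comul_serre_f.
Qed.

Let tC := @tin_algC F Uq Uq.

Lemma uq_comul_linear : linear uq_comul.
Proof.
move=> c x y; rewrite /uq_comul (pliftD tC uq_comul_rel).
by rewrite (pliftZ tC uq_comul_rel) tin_algE.
Qed.

Lemma uq_comul_monoid : monoid_morphism uq_comul.
Proof.
split; first exact: (plift1 tC uq_comul_rel).
exact: (pliftM tC uq_comul_rel).
Qed.

HB.instance Definition _ :=
  GRing.isLinear.Build F Uq (tensor Uq Uq) *:%R uq_comul uq_comul_linear.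
HB.instance Definition _ :=
  GRing.isMonoidMorphism.Build Uq (tensor Uq Uq) uq_comul uq_comul_monoid.

Lemma uq_comulE x : uq_comul (pgen uq_rel x) = uq_comul_gen x.
Proof. exact: (plift_gen tC uq_comul_rel). Qed.

Lemma uq_counitE x : uq_counit (pgen uq_rel x) = uq_counit_gen x.
Proof. exact: (plift_gen idC uq_counit_rel). Qed.

End UqDef.

(* pi is an algebra morphism H -> End_F(A) such that, for the bialgebra
   (H, Delta, epsilon), pi(h)(ab) = \sum pi(h')(a) pi(h'')(b) whenever
   Delta(h) = \sum h' (x) h'', and pi(h)(1) = epsilon(h) 1.  The antipode of a
   Hopf algebra plays no part in this notion.  By tensor_sum, Delta(h) always
   is such a sum. *)
Definition module_algebra (F : fieldType) (H A : algType F)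
    (Delta : {lrmorphism H -> tensor H H}) (epsilon : {lrmorphism H -> F^o})
    (pi : H -> {linear A -> A}) : Prop :=
  [/\ forall a, linear (fun h => pi h a),
      (forall a, pi 1 a = a) /\ (forall g h a, pi (g * h) a = pi g (pi h a)),
      forall h (s : seq (H * H)), Delta h = \sum_(p <- s) p.1 \ot p.2 ->
        forall a b, pi h (a * b) = \sum_(p <- s) pi p.1 a * pi p.2 b
    & forall h, pi h 1 = epsilon h *: 1].

Inductive action_type :=
| TypeD
| TypeA of nat
| TypeB of nat
| TypeC of nat.

(* The parameters: the signs (-1) ^+ sg i for type D, and the nonzero scalar c,
   which is a_j, b_j or c_{j+1,j} for type A_j, B_j or C_j. *)
Definition acts_as (F : fieldType) (n : nat) (q : F) (t : action_type)
    (sg : nat -> bool) (c : F) (k e f : qspace n q -> qspace n q) : Prop :=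
  forall i, (1 <= i <= n)%N ->
  let x := @qx F n q in
  match t with
  | TypeD => [/\ k (x i) = (-1) ^+ sg i *: x i, e (x i) = 0 & f (x i) = 0]
  | TypeA j =>
    [/\ k (x i) = (if (i < j)%N then q else if i == j then q ^- 2 else q^-1) *: x i,
        e (x i) = (if i == j then c%:A else 0)
      & f (x i) = if (i < j)%N then c^-1 *: (x i * x j)
                  else if i == j then - q * c^-1 *: x j ^+ 2
                  else - q * c^-1 *: (x j * x i)]
  | TypeB j =>
    [/\ k (x i) = (if (i < j)%N then q else if i == j then q ^+ 2 else q^-1) *: x i,
        e (x i) = (if (i < j)%N then - q * c^-1 *: (x i * x j)
                   else if i == j then - q * c^-1 *: x j ^+ 2
                   else c^-1 *: (x j * x i))
      & f (x i) = if i == j then c%:A else 0]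
  | TypeC j =>
    [/\ k (x i) = (if i == j then q else if i == j.+1 then q^-1 else 1) *: x i,
        e (x i) = (if i == j.+1 then c *: x j else 0)
      & f (x i) = if i == j then c^-1 *: x j.+1 else 0]
  end.

(* A chain X_1 - ... - X_m is the sequence of its m types; reading it from right
   to left assigns X_{m+1-s} to the s-th vertex. *)
Inductive action_chain (m n : nat) : seq action_type -> Prop :=
| chain_D : action_chain m n (nseq m TypeD)
| chain_AC i : (1 <= i)%N -> (i + m - 2 <= n - 1)%N ->
    action_chain m n (TypeA i :: [seq TypeC j | j <- iota i (m - 1)])
| chain_CB i : (1 <= i)%N -> (i + m - 2 <= n - 1)%N ->
    action_chain m n (rcons [seq TypeC j | j <- iota i (m - 1)] (TypeB (i + m - 1)))
| chain_C i : (1 <= i)%N -> (i + m - 1 <= n - 1)%N ->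
    action_chain m n [seq TypeC j | j <- iota i m]
| chain_ABC : (1 < n + 2 - m)%N ->
    action_chain m n
      [:: TypeA 1, TypeB n & [seq TypeC (n - j) | j <- iota 1 (m - 2)]]
| chain_BAC : (m - 2 < n - 1)%N ->
    action_chain m n [:: TypeB n, TypeA 1 & [seq TypeC j | j <- iota 1 (m - 2)]].

(* The generators of U_q(sl(m+1)) are indexed from 0, by 'I_m, whereas the
   indices occurring in the action types are counted from 1. *)
Definition acts_by_chain (F : fieldType) (m n : nat) (q : F)
    (ch : seq action_type) (sg : 'I_m -> nat -> bool) (c : 'I_m -> F)
    (pi : Uq m q -> {linear qspace n q -> qspace n q}) : Prop :=
  forall s : 'I_m,
    acts_as (nth TypeD ch s) (sg s) (c s) (pi (uqk q s)) (pi (uqe q s)) (pi (uqf q s)).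

(* Main.v *)
Require Import Defs.
From HB Require Import structures.
From mathcomp Require Import all_boot all_order all_algebra.
From mathcomp Require Import boolp reals.
From mathcomp.real_closed Require Import complex.
From mathcomp.algebra_tactics Require Import ring.
From mathcomp Require Import zify.

Set Implicit Arguments.
Unset Strict Implicit.
Unset Printing Implicit Defensive.

Import Order.TTheory GRing.Theory Num.Theory.
Local Open Scope ring_scope.

(** A vertex of a chain is a quadruple of operators k, k^-1, e, f on A_q(n): k
    is an algebra automorphism, and e and f obey the Leibniz rules
      e(ab) = a e(b) + e(a) k(b)   and   f(ab) = k^-1(a) f(b) + f(a) b
    that the coproduct dictates.  Such operators exist as soon as the prescribed
    values on the generators respect x_i x_j = q x_j x_i ([qskew_exists]).  A
    family of vertices that satisfies the defining relations of U_q(sl(m+1)) is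
    a module algebra structure: the formula for h(ab) holds for the generators h
    by the Leibniz rules, and it passes to sums and products of such h
    ([uq_op_module_algebra]).

    What remains is to check the relations, and each of them involves at most
    two vertices.  For any of them that involves e or f, the difference of its
    two sides is again a skew derivation, so that it vanishes if it kills every
    x_i; for the Serre relations this is the computation [opserre_skew].  In type C, and for e in
    type A and f in type B, each generator goes to 0, to a scalar or to a
    multiple of one generator, and the relations are visible on the generators.

    The other two operators, f in type A_j and e in type B_j, have quadratic
    values, but they are inner: with lambda = 1 / (a (q^-1 - q)),
      f(y) = lambda (k^-1(y) x_j - x_j y),   e(y) = lambda (x_j k(y) - y x_j),
    where a is the parameter of the type.  A relation between an inner operator
    and another vertex then holds on the whole algebra for a reason that only
    concerns the effect of that vertex on x_j ([inner_cross], [inner_comm],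
    [inner_serre]).

    Up to order, the neighbours in the six families of chains are D - D,
    A_i - C_i, C_i - C_(i+1), C_i - B_(i+1) and A_1 - B_n; the vertices that are
    not neighbours are D - D, A_i - C_j with i < j, C_i - C_j with i + 1 < j, and
    C_i - B_j with i + 1 < j.  As the relations between two vertices are
    symmetric in these vertices, a chain may be read in both directions. *)

(** * Skew derivations for an abstract product *)

(** Reversing the product of an algebra exchanges the Leibniz rules of e and f
    (with k replaced by k^-1).  With the product as a parameter, one computation
    serves both. *)
Record assoc_mul (F : fieldType) (V : lmodType F) := AssocMul {
  amul :> V -> V -> V;
  amulDl : forall a b c, amul (a + b) c = amul a c + amul b c;
  amulDr : forall a b c, amul a (b + c) = amul a b + amul a c;
  amulZl : forall s a b, amul (s *: a) b = s *: amul a b;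
  amulZr : forall s a b, amul a (s *: b) = s *: amul a b;
  amulA : forall a b c, amul a (amul b c) = amul (amul a b) c }.

Section AssocMul.
Variables (F : fieldType) (V : lmodType F) (mu : assoc_mul V).

Lemma amulNl a b : mu (- a) b = - mu a b.
Proof. by rewrite -scaleN1r amulZl scaleN1r. Qed.

Lemma amulNr a b : mu a (- b) = - mu a b.
Proof. by rewrite -scaleN1r amulZr scaleN1r. Qed.

Lemma amul0l b : mu 0 b = 0.
Proof. by rewrite -[X in mu X _](scale0r (0 : V)) amulZl scale0r. Qed.

Lemma amul0r a : mu a 0 = 0.
Proof. by rewrite -[X in mu _ X](scale0r (0 : V)) amulZr scale0r. Qed.

End AssocMul.

Section TwoMuls.
Variables (F : fieldType) (A : algType F).

Definition left_mul : assoc_mul A :=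
  @AssocMul F A *%R (@mulrDl A) (@mulrDr A)
    (fun s a b => esym (scalerAl s a b)) (fun s a b => esym (scalerAr s a b))
    (@mulrA A).

Definition right_mul : assoc_mul A :=
  @AssocMul F A (fun a b => b * a)
    (fun a b c => mulrDr c a b) (fun a b c => mulrDl b c a)
    (fun s a b => esym (scalerAr s b a)) (fun s a b => esym (scalerAl s b a))
    (fun a b c => esym (mulrA c b a)).

End TwoMuls.

Section Serre.
Variables (F : fieldType) (V : lmodType F) (q : F).
Hypothesis q_neq0 : q != 0.
Implicit Types e f : {linear V -> V}.

Definition opcomm e f : {linear V -> V} := (e \o f) \- (f \o e).

Definition opserre e f : {linear V -> V} :=
  ((e \o e \o f) \- (q + q^-1) \*: (e \o f \o e)) \+ (f \o e \o e).

Section Skew.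
Variables (mu : assoc_mul V) (k l : {linear V -> V}) (e f : {linear V -> V}).
Hypothesis eM : forall a b, e (mu a b) = mu a (e b) + mu (e a) (k b).
Hypothesis fM : forall a b, f (mu a b) = mu a (f b) + mu (f a) (l b).
Hypothesis kl : forall a, l (k a) = k (l a).
Hypothesis ke : forall a, k (e a) = q ^+ 2 *: e (k a).
Hypothesis kf : forall a, k (f a) = q^-1 *: f (k a).
Hypothesis le : forall a, l (e a) = q^-1 *: e (l a).

(** The Serre element is primitive up to grouplike factors: all mixed terms of
    its coproduct cancel.  With E = ef - q^-1 fe it equals eE - q Ee, and the
    only mixed term in the Leibniz rule of E is (1 - q^-2) f(a) e(l(b)), which
    makes the cancellation short. *)
Lemma opserre_skew a b :
  opserre e f (mu a b) = mu a (opserre e f b) + mu (opserre e f a) (k (k (l b))).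
Proof.
pose E x := e (f x) - q^-1 *: f (e x).
pose s := 1 - q ^- 2.
have EM a' b' :
    E (mu a' b') = mu a' (E b') + mu (E a') (k (l b')) + s *: mu (f a') (e (l b')).
  rewrite /E eM fM !linearD /= !eM !fM kf le kl !(amulDl, amulDr, amulNl, amulNr).
  rewrite !(amulZl, amulZr, scalerDr) !opprD !scalerA -invfM -expr2.
  rewrite /s scalerBl scale1r.
  by rewrite [LHS](AC ((2*2)*(2*2)) ((1*5)*(4*8)*(3*6)*(2*7))) /= subrr addr0 addrA.
have serreE x : opserre e f x = e (E x) - q *: E (e x).
  rewrite /opserre /= /E !linearB !linearZ /= !scalerA divff // scale1r.
  by rewrite scalerDl opprK [q *: _ + _]addrC !addrA.
have kE x : k (E x) = q *: E (k x).
  rewrite /E linearB linearZ /= !(ke, kf) !linearZ /= scalerDr !scalerA.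
  by congr (_ *: _ + _ *: _); field.
have sq : s * q ^+ 2 = q ^+ 2 - 1 by rewrite /s; field.
have ED x y : E (x + y) = E x + E y.
  by rewrite /E !linearD /= addrACA.
have EE x : e (f x) = E x + q^-1 *: f (e x) by rewrite /E subrK.
have eZ c x : e (c *: x) = c *: e x by exact: linearZ.
have kZ c x : k (c *: x) = c *: k x by exact: linearZ.
rewrite !serreE; clearbody E s.
rewrite EM [e (mu a b)]eM ED !EM !(linearD e) eZ !eM kE.
rewrite !(kl, le, ke) !(amulZr, eZ, kZ) !ke EE.
rewrite !(amulZr, amulDl, amulNr, amulNl, amulZl).
rewrite !(amulDr, amulNr, amulZr, scalerDr, scalerA, opprD).
have -> : s * q ^+ 2 / q = q * s by field.
have -> : q * (q^-1 * q ^+ 2) = q ^+ 2 by field.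
have -> : q * s / q = s by field.
rewrite sq scalerBl scale1r.
(* Keep the four terms of the right-hand side; the others cancel in pairs. *)
rewrite [LHS](AC (((2*2)*(1*(2*1)))*(3*3))
  (((1*9)*(4*13))*((2*12)*(3*7)*(5*11)*(6*10)*(8*14)))) /=.
by rewrite !subrr !addr0.
Qed.

End Skew.
End Serre.

(** * Inner skew derivations *)
Section Inner.
Variables (F : fieldType) (V : lmodType F) (mu : assoc_mul V) (q : F).
Hypothesis q_neq0 : q != 0.
Variables (u : V) (lam : F) (K : {linear V -> V}) (D : {linear V -> V}).
Hypothesis DE : forall y, D y = lam *: (mu (K y) u - mu u y).

(** H satisfies the opposite Leibniz rule: if D is an operator f, then H is an
    operator e.  This covers both a vanishing H u, when H and D commute, and a
    scalar H u, which produces the difference of K and M as in the commutator of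
    e and f at one vertex. *)
Lemma inner_cross (p : F) (H M : {linear V -> V}) :
  p != 0 ->
  (forall b c, H (mu b c) = mu b (H c) + mu (H b) (M c)) ->
  M u = p *: u -> (forall y, H (K y) = p^-1 *: K (H y)) ->
  forall y, H (D y) - D (H y) = lam *: (mu (K y) (H u) - mu (H u) (M y)).
Proof.
move=> p0 HM Mu HK y; rewrite !DE linearZ linearB /= !HM Mu HK.
rewrite amulZl amulZr scalerA mulVf // scale1r -scalerBr; congr (_ *: _).
rewrite !opprD opprK [LHS](AC (2*2*2) ((1*4)*((2*5)*(3*6)))) /=.
by rewrite subrr addNr !addr0.
Qed.

Variables (G L : {linear V -> V}).
Hypothesis GM : forall b c, G (mu b c) = mu (L b) (G c) + mu (G b) c.

Lemma inner_comm : L u = u -> G u = 0 -> (forall y, G (K y) = K (G y)) ->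
  forall y, G (D y) = D (G y).
Proof.
move=> Lu Gu GK y; rewrite !DE linearZ linearB /= !GM Lu Gu GK.
by rewrite amul0r amul0l add0r addr0.
Qed.

Hypothesis KM : forall b c, K (mu b c) = mu (K b) (K c).
Hypothesis LM : forall b c, L (mu b c) = mu (L b) (L c).
Hypothesis LK : forall y, L (K y) = K (L y).
Hypothesis GK : forall y, G (K y) = q *: K (G y).
Hypothesis GL : forall y, G (L y) = q ^- 2 *: L (G y).
Hypothesis Ku : K u = q ^+ 2 *: u.
Hypothesis Lu : L u = q^-1 *: u.
Hypothesis GGu : G (G u) = 0.
Hypothesis Guu : mu (G u) u = q *: mu u (G u).

(** Put u' = G u and s = q - q^-1.  The q-commutator E = GD - q DG is equal to
    lambda times J + s u G, where J y = L K y u' - u' y is again inner.  Both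
    Serre elements are q-commutators with E,
      GE - q^-1 EG   and   ED - q^-1 DE,
    and they vanish because u and u' commute up to q.  This includes the
    case u' = 0, where J = 0. *)
Lemma inner_serre :
  (forall y, opserre q G D y = 0) /\ (forall y, opserre q D G y = 0).
Proof.
pose u' := G u; pose s := q - q^-1.
pose J y := mu (L (K y)) u' - mu u' y.
pose E y := G (D y) - q *: D (G y).
have DZ c y : D (c *: y) = c *: D y by exact: linearZ.
have DD y z : D (y + z) = D y + D z by exact: linearD.
have DN y : D (- y) = - D y by exact: linearN.
have GZ c y : G (c *: y) = c *: G y by exact: linearZ.
have GD y z : G (y + z) = G y + G z by exact: linearD.
have GN y : G (- y) = - G y by exact: linearN.
have KD y z : K (y + z) = K y + K z by exact: linearD.
have KN y : K (- y) = - K y by exact: linearN.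
have LD y z : L (y + z) = L y + L z by exact: linearD.
have LN y : L (- y) = - L y by exact: linearN.
have KZ c y : K (c *: y) = c *: K y by exact: linearZ.
have LZ c y : L (c *: y) = c *: L y by exact: linearZ.
have Ku' : K u' = q *: u'.
  apply: (scalerI q_neq0); rewrite -GK Ku GZ scalerA; congr (_ *: _); ring.
have Lu' : L u' = q *: u'.
  have := GL u; rewrite Lu GZ -/u' => /(congr1 (GRing.scale (q ^+ 2))).
  rewrite !scalerA mulfV ?expf_neq0 // scale1r => <-.
  by congr (_ *: _); field.
have muE := (amulDl mu, amulDr mu, amulNl mu, amulNr mu, amulZl mu, amulZr mu,
  amulA mu).
have EE y : E y = lam *: (J y + s *: mu u (G y)).
  rewrite /E !DE GZ scalerA [q * lam]mulrC -scalerA -scalerBr; congr (_ *: _).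
  rewrite /J GD GN !GM Lu GK amulZl amulZl scalerBr -/u' scalerBl.
  rewrite !opprD opprK [LHS](AC (2*2*2) ((1*4)*((6*3)*(2*5)))) /=.
  by rewrite subrr addr0.
have GJ y : G (J y) = q^-1 *: mu (L (K (G y))) u' - q *: mu u' (G y).
  rewrite /J GD GN !GM GGu amul0r amul0l add0r addr0 GL GK LZ scalerA amulZl Lu'.
  by rewrite amulZl; congr (_ *: _ - _); field.
have GuG y : G (mu u (G y)) = q^-1 *: mu u (G (G y)) + mu u' (G y).
  by rewrite GM Lu amulZl.
have uu' z : mu (mu z u') u = q *: mu (mu z u) u'.
  by rewrite -amulA Guu amulZr amulA.
have z0 (c : F) (y : V) : c = 0 -> c *: y = 0 by move=> ->; rewrite scale0r.
have DJ y : D (J y) = lam *: ((q * q) *: mu (mu (L (K (K y))) u) u'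
    - q *: mu (mu u' (K y)) u - mu (mu u (L (K y))) u' + mu (mu u u') y).
  rewrite DE /J KD KN !KM Ku' -LK; congr (_ *: _).
  by rewrite !muE -[mu u u']/(mu u u') uu' !scalerA !opprD opprK !addrA.
have JD y : J (D y) = lam *: (q *: mu (mu (L (K (K y))) u) u'
    - q *: mu (mu u (L (K y))) u' - 1 *: mu (mu u' (K y)) u
    + q *: mu (mu u u') y).
  rewrite /J DE KZ KD KN !KM LZ LD LN !LM Ku LZ Lu !muE Guu !muE scalerA scale1r.
  rewrite -scalerBr opprD opprK !addrA !scalerA.
  have -> : q ^+ 2 / q = q by field.
  by [].
have DuG y : D (mu u (G y)) =
    lam *: (q ^+ 2 *: mu (mu u (K (G y))) u - mu (mu u u) (G y)).
  by rewrite DE KM Ku !amulZl amulA.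
have uDG y : mu u (D (G y)) =
    lam *: (mu (mu u (K (G y))) u - mu (mu u u) (G y)).
  by rewrite DE !muE.
have uE y : mu u (E y) = lam *: (mu (mu u (L (K y))) u' - mu (mu u u') y
    + s *: mu (mu u u) (G y)).
  by rewrite EE /J !muE.
split=> y.
- have -> : opserre q G D y = G (E y) - q^-1 *: E (G y).
    rewrite /opserre /= /E GD GN GZ scalerBr scalerA mulVf // scale1r.
    by rewrite scalerDl !opprD opprK !addrA.
  rewrite !EE GZ GD GZ GJ GuG /J [q^-1 *: (lam *: _)]scalerA [q^-1 * lam]mulrC.
  rewrite -scalerA -scalerBr !(scalerDr, scalerN, scalerA, opprD, opprK).
  (* Collected by monomial, every coefficient is 0. *)
  rewrite [LHS](AC ((2*2)*(2*1)) ((1*5)*(3*7)*(2*4*6))) /=.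
  rewrite -!scaleNr -!scalerDl !z0 ?addr0 //; by rewrite /s; field.
- have -> : opserre q D G y = E (D y) - q^-1 *: D (E y).
    rewrite /opserre /= /E DD DN DZ scalerBr scalerA mulVf // scale1r.
    rewrite scalerDl !opprD opprK [LHS]addrC [D (D _) + _]addrC.
    by rewrite !addrA.
  rewrite !EE JD -[G (D y)](subrK (q *: D (G y))) -/(E y).
  rewrite [mu u (_ + _)]amulDr uE amulZr uDG DZ DD DZ DJ DuG.
  rewrite !(scalerDr, scalerN, scalerA, opprD, opprK).
  (* Again, collected by monomial, every coefficient is 0. *)
  rewrite [LHS](AC ((4*(3*2))*(4*2))
    ((1*10)*(2*5*12)*(3*11)*(4*6*13)*(8*14)*(7*9*15))) /=.
  by rewrite -!scaleNr -!scalerDl !z0 ?addr0 //; rewrite /s; field.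
Qed.
End Inner.

(** * From operators to module algebras *)
Section SkewSl2.
Variables (F : fieldType) (A : algType F).

Record skew_sl2 := SkewSl2 {
  opk : {linear A -> A};
  opkV : {linear A -> A};
  ope : {linear A -> A};
  opf : {linear A -> A};
  opk1 : opk 1 = 1;
  opkM : {morph opk : a b / a * b};
  opkK : cancel opk opkV;
  opkVK : cancel opkV opk;
  opeM : forall a b, ope (a * b) = a * ope b + ope a * opk b;
  opfM : forall a b, opf (a * b) = opkV a * opf b + opf a * b }.

Lemma opkV1 v : opkV v 1 = 1.
Proof. by rewrite -{1}(opk1 v) opkK. Qed.

Lemma opkVM v : {morph opkV v : a b / a * b}.
Proof. by move=> a b; rewrite -{1}(opkVK v a) -{1}(opkVK v b) -opkM opkK. Qed.

Lemma ope1 v : ope v 1 = 0.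
Proof.
have := opeM v 1 1; rewrite !(mulr1, mul1r) opk1 mulr1 => /eqP.
by rewrite -subr_eq subrr => /eqP.
Qed.

Lemma opf1 v : opf v 1 = 0.
Proof.
have := opfM v 1 1; rewrite !(mulr1, mul1r) opkV1 mul1r => /eqP.
by rewrite -subr_eq subrr => /eqP.
Qed.

End SkewSl2.

Section UqAction.
Variables (F : fieldType) (A : algType F) (m : nat) (q : F).
Variable v : 'I_m -> skew_sl2 A.
Local Notation Uq := (Uq m q).

Definition uq_genop (x : uqgen m) : {linear A -> A} :=
  match x with
  | UqE i => ope (v i)
  | UqF i => opf (v i)
  | UqK i => opk (v i)
  | UqKV i => opkV (v i)
  end.

(** Words in the generators act by themselves; the relations enter only when
    the action is shown to depend on the class of the word. *)
Fixpoint uq_exprop (t : ncexpr F (uqgen m)) (a : A) : A :=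
  match t with
  | NCgen x => uq_genop x a
  | NCcst c => c *: a
  | NCadd t u => uq_exprop t a + uq_exprop u a
  | NCmul t u => uq_exprop t (uq_exprop u a)
  end.

Lemma uq_exprop_linear t : linear (uq_exprop t).
Proof.
elim: t => [x|d|t IHt u IHu|t IHt u IHu] c a b /=.
- exact: linearP.
- by rewrite scalerDr !scalerA mulrC.
- by rewrite IHt IHu scalerDr addrACA.
- by rewrite IHu IHt.
Qed.

HB.instance Definition _ t :=
  GRing.isLinear.Build F A A *:%R (uq_exprop t) (uq_exprop_linear t).

Hypothesis uq_exprop_rel :
  forall t u, uq_rel q t u -> uq_exprop t =1 uq_exprop u.

Lemma uq_exprop_cong t u : nccong (@uq_rel F m q) t u -> uq_exprop t =1 uq_exprop u.
Proof.
elim=> {t u} /=.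
- exact: uq_exprop_rel.
- by [].
- by move=> t u _ IH a; rewrite IH.
- by move=> t u w _ IH _ IH' a; rewrite IH IH'.
- by move=> t t' u u' _ IH _ IH' a /=; rewrite IH IH'.
- by move=> t t' u u' _ IH _ IH' a /=; rewrite IH IH'.
- by move=> t u w a /=; rewrite addrA.
- by move=> t u a /=; rewrite addrC.
- by move=> t a /=; rewrite scale0r add0r.
- by move=> t a /=; rewrite scaleN1r subrr scale0r.
- by [].
- by move=> t a /=; rewrite scale1r.
- by [].
- by move=> t u w a /=; rewrite linearD.
- by move=> c d a /=; rewrite scalerDl.
- by move=> c d a /=; rewrite scalerA.
- by move=> c t a /=; rewrite linearZ.
Qed.

Definition uq_op (h : Uq) : {linear A -> A} := uq_exprop (prepr h).

Lemma uq_op_class t : uq_op (pclass (@uq_rel F m q) t) =1 uq_exprop t.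
Proof. exact/uq_exprop_cong/nccong_repr. Qed.

Lemma uq_op_gen x : uq_op (pgen (@uq_rel F m q) x) =1 uq_genop x.
Proof. exact: uq_op_class. Qed.

Lemma uq_op_linear a : linear (uq_op^~ a).
Proof.
move=> c g h; have [t ->] := pclass_surj g; have [u ->] := pclass_surj h.
by rewrite -pclassZ -pclassD !uq_op_class.
Qed.

Lemma uq_opZ c h a : uq_op (c *: h) a = c *: uq_op h a.
Proof. by have [t ->] := pclass_surj h; rewrite -pclassZ !uq_op_class. Qed.

Lemma uq_op1 a : uq_op 1 a = a.
Proof. by rewrite -pclass1 uq_op_class /= scale1r. Qed.

Lemma uq_opM g h a : uq_op (g * h) a = uq_op g (uq_op h a).
Proof.
have [t ->] := pclass_surj g; have [u ->] := pclass_surj h.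
by rewrite -pclassM !uq_op_class.
Qed.

(** The operator g (x) h on A (x) A, applied to a (x) b and followed by the
    product of A. *)
Definition tensor_op (a b : A) : tensor Uq Uq -> A :=
  tlift (fun g h => uq_op g a * uq_op h b).

Lemma tensor_op_pure a b g h : tensor_op a b (g \ot h) = uq_op g a * uq_op h b.
Proof.
rewrite /tensor_op tlift_pure // => [h' c x y | g' c x y].
  by rewrite uq_op_linear mulrDl -scalerAl.
by rewrite uq_op_linear mulrDr -scalerAr.
Qed.

Lemma tensor_op_linear a b : linear (tensor_op a b).
Proof.
apply: tlift_linear => [h' c x y | g' c x y].
  by rewrite uq_op_linear mulrDl -scalerAl.
by rewrite uq_op_linear mulrDr -scalerAr.
Qed.

HB.instance Definition _ a b :=
  GRing.isLinear.Build F (tensor Uq Uq) A *:%R (tensor_op a b)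
    (tensor_op_linear a b).

Lemma tensor_opM_pure a b X g h :
  tensor_op a b (X * (g \ot h)) = tensor_op (uq_op g a) (uq_op h b) X.
Proof.
elim/tensor_ind: X => [|g' h'|X Y IHX IHY|c X IHX].
- by rewrite mul0r !linear0.
- by rewrite tpureM !tensor_op_pure !uq_opM.
- by rewrite mulrDl !linearD /= IHX IHY.
- by rewrite -tscalerAl !linearZ /= IHX.
Qed.

(** Induction on a word for h.  For a product gh, expand Delta(h) into pure
    tensors and apply the induction hypothesis of g to each of the resulting
    products in A. *)
Lemma uq_op_comul h a b : uq_op h (a * b) = tensor_op a b (@uq_comul F m q h).
Proof.
have [t ->] := pclass_surj h.
elim: t a b => [x|c|t IHt u IHu|t IHt u IHu] a b.
- rewrite -[pclass _ _]/(pgen (@uq_rel F m q) x) uq_op_gen uq_comulE.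
  case: x => i /=; rewrite ?linearD /= !tensor_op_pure ?uq_op1 !uq_op_gen //=.
  + exact: opeM.
  + exact: opfM.
  + exact: opkM.
  + exact: opkVM.
- have -> : pclass (@uq_rel F m q) (NCcst c) = (c *: (1 : Uq) : Uq).
    rewrite -[1]/(pclass (@uq_rel F m q) 1) -pclassZ.
    by rewrite pclassM pclass1 mulr1.
  by rewrite linearZ rmorph1 linearZ /= -tpure11 tensor_op_pure uq_opZ !uq_op1.
- by rewrite uq_op_class pclassD !linearD /= -2!uq_op_class IHt IHu.
- rewrite pclassM rmorphM /= uq_opM IHu.
  have [s ->] := tensor_sum (@uq_comul F m q (pclass (@uq_rel F m q) u)).
  rewrite mulr_sumr !linear_sum /=; apply: eq_bigr => -[g h'] _ /=.
  by rewrite tensor_op_pure IHt tensor_opM_pure.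
Qed.

Lemma uq_op_counit h : uq_op h 1 = @uq_counit F m q h *: 1.
Proof.
have relC t u : uq_rel q t u ->
    nceval idfun (@uq_counit_gen F m) t = nceval idfun (@uq_counit_gen F m) u.
  exact: uq_counit_rel.
have [t ->] := pclass_surj h; rewrite uq_op_class /uq_counit.
rewrite (plift_class _ relC); last by move=> c x; rewrite /= mulrC.
elim: t => [[]i|c|t IHt u IHu|t IHt u IHu] /=.
- by rewrite ope1 scale0r.
- by rewrite opf1 scale0r.
- by rewrite opk1 scale1r.
- by rewrite opkV1 scale1r.
- by [].
- by rewrite IHt IHu scalerDl.
- by rewrite IHu linearZ /= IHt scalerA mulrC.
Qed.

Theorem uq_op_module_algebra :
  module_algebra (@uq_comul F m q) (@uq_counit F m q) uq_op.
Proof.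
split.
- exact: uq_op_linear.
- by split; [exact: uq_op1 | exact: uq_opM].
- move=> h s Ds a b; rewrite uq_op_comul Ds linear_sum /=.
  by apply: eq_bigr => p _; rewrite tensor_op_pure.
- exact: uq_op_counit.
Qed.

End UqAction.

(** * The defining relations *)
Section Relations.
Variables (F : fieldType) (A : algType F) (q : F).
Implicit Types (v w : skew_sl2 A) (a : int).

Definition weight_rel a v w :=
  [/\ forall y, opk v (opk w y) = opk w (opk v y),
      forall y, opk v (ope w y) = q ^ a *: ope w (opk v y)
    & forall y, opk v (opf w y) = q ^ (- a) *: opf w (opk v y)].

Definition cross_rel v w := forall y, ope v (opf w y) = opf w (ope v y).

Definition serre_rel (e f : {linear A -> A}) := forall y, opserre q e f y = 0.

Definition vertex_rel v := weight_rel 2 v v /\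
  forall y, ope v (opf v y) - opf v (ope v y)
              = (q - q^-1)^-1 *: (opk v y - opkV v y).

(** All relations between two distinct vertices with Cartan entry a, in both
    orders, which makes the notion symmetric. *)
Definition pair_rel a v w :=
  [/\ weight_rel a v w /\ weight_rel a w v,
      cross_rel v w /\ cross_rel w v,
      a = -1 -> (serre_rel (ope v) (ope w) /\ serre_rel (ope w) (ope v)) /\
                (serre_rel (opf v) (opf w) /\ serre_rel (opf w) (opf v))
    & a = 0 -> (forall y, ope v (ope w y) = ope w (ope v y)) /\
               (forall y, opf v (opf w y) = opf w (opf v y))].

Lemma pair_relC a v w : pair_rel a v w -> pair_rel a w v.
Proof.
case=> [[? ?] [? ?] serre comm]; split=> // a0.
  by have [[? ?] [? ?]] := serre a0.
by have [ee ff] := comm a0; split=> y; rewrite (ee, ff).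
Qed.

Lemma weight_kVe a v w : q != 0 -> weight_rel a v w ->
  forall y, opkV v (ope w y) = q ^ (- a) *: ope w (opkV v y).
Proof.
move=> q0 [_ ke _] y; rewrite -{1}(opkVK v y).
have := congr1 (opkV v) (ke (opkV v y)).
rewrite opkK linearZ /= => ->.
by rewrite scalerA -expfzDr // addNr expr0z scale1r.
Qed.

Lemma weight_kVf a v w : q != 0 -> weight_rel a v w ->
  forall y, opkV v (opf w y) = q ^ a *: opf w (opkV v y).
Proof.
move=> q0 [_ _ kf] y; rewrite -{1}(opkVK v y).
have := congr1 (opkV v) (kf (opkV v y)).
rewrite opkK linearZ /= => ->.
by rewrite scalerA -expfzDr // addrN expr0z scale1r.
Qed.

Lemma weight_kVkV a v w : weight_rel a v w ->
  forall y, opkV v (opkV w y) = opkV w (opkV v y).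
Proof.
move=> [kk _ _] y.
have := kk (opkV w (opkV v y)); rewrite opkVK opkVK => {1}->.
by rewrite !opkK.
Qed.

Lemma uq_exprop_relP (m : nat) (v : 'I_m -> skew_sl2 A) :
  (forall i, vertex_rel (v i)) ->
  (forall i j : 'I_m, i != j -> pair_rel (cartan i j) (v i) (v j)) ->
  forall t u, uq_rel q t u -> uq_exprop v t =1 uq_exprop v u.
Proof.
move=> vertexP pairP.
have weightP (i j : 'I_m) : weight_rel (cartan i j) (v i) (v j).
  have [->|ij] := eqVneq i j; last by have [[]] := pairP i j ij.
  by rewrite /cartan eqxx; have [] := vertexP j.
have neq (i j : 'I_m) : cartan i j != 2 -> i != j.
  by apply: contraNneq => ->; rewrite /cartan eqxx.
move=> _ _ [i|i|i j|i j|i j|i|i j ij|i j aij|i j aij|i j aij|i j aij] y /=.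
- by rewrite opkVK scale1r.
- by rewrite opkK scale1r.
- by have [-> _ _] := weightP i j.
- by have [_ -> _] := weightP i j; rewrite opkVK.
- by have [_ _ ->] := weightP i j; rewrite opkVK.
- by rewrite !scaleN1r; have [_ ->] := vertexP i.
- by rewrite scaleN1r scale0r; have [_ [-> _] _ _] := pairP i j ij; rewrite subrr.
- have ij : i != j by apply: neq; rewrite aij.
  by have [_ _ _ /(_ aij)[-> _]] := pairP i j ij.
- have ij : i != j by apply: neq; rewrite aij.
  by have [_ _ _ /(_ aij)[_ ->]] := pairP i j ij.
- have ij : i != j by apply: neq; rewrite aij.
  have [_ _ /(_ aij)[[/(_ y) + _] _] _] := pairP i j ij.
  by rewrite /opserre /= scaleN1r scale0r.
- have ij : i != j by apply: neq; rewrite aij.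
  have [_ _ /(_ aij)[_ [/(_ y) + _]] _] := pairP i j ij.
  by rewrite /opserre /= scaleN1r scale0r.
Qed.

End Relations.


(** * Relations with an inner operator *)
Section InnerVertices.
Variables (F : fieldType) (A : algType F) (q : F).
Hypothesis q_neq0 : q != 0.
Variables (v w : skew_sl2 A) (u : A) (lam : F).

Section InnerF.
Hypothesis fE : forall y, opf v y = lam *: (opkV v y * u - u * y).

Lemma inner_f_cross (a : int) : weight_rel q a v w -> opk w u = q ^ (- a) *: u ->
  forall y, ope w (opf v y) - opf v (ope w y)
              = lam *: (opkV v y * ope w u - ope w u * opk w y).
Proof.
move=> vw wu y.
apply: (inner_cross (mu := left_mul A) fE (p := q ^ (- a))) => //.
- by rewrite expfz_neq0.
- exact: opeM.
- move=> z; rewrite (weight_kVe q_neq0 vw) scalerA mulVf ?scale1r //.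
  by rewrite expfz_neq0.
Qed.

Lemma inner_f_comm : weight_rel q 0 v w -> opkV w u = u -> opf w u = 0 ->
  forall y, opf w (opf v y) = opf v (opf w y).
Proof.
move=> vw wu fu; apply: (inner_comm (mu := left_mul A) fE (opfM w)) => // z.
by rewrite (weight_kVf q_neq0 vw) expr0z scale1r.
Qed.

(** Besides the weight relations between v and w, only u and f_w(u) matter: the
    weights of u, the vanishing of f_w on f_w(u), and how f_w(u) commutes with
    u. *)
Lemma inner_f_serre : weight_rel q 2 w w -> weight_rel q (-1) v w ->
  opkV v u = q ^+ 2 *: u -> opkV w u = q^-1 *: u -> opf w (opf w u) = 0 ->
  opf w u * u = q *: (u * opf w u) ->
  serre_rel q (opf w) (opf v) /\ serre_rel q (opf v) (opf w).
Proof.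
move=> ww vw vu wu ffu fuu.
apply: (inner_serre (mu := left_mul A) q_neq0 fE (opfM w)) => // [||z|z|z].
- exact: opkVM.
- exact: opkVM.
- by rewrite (weight_kVkV vw).
- by rewrite (weight_kVf q_neq0 vw) scalerA mulfV // scale1r.
- rewrite (weight_kVf q_neq0 ww) scalerA mulVf ?scale1r //.
  by rewrite expf_neq0.
Qed.

End InnerF.

Section InnerE.
Hypothesis eE : forall y, ope v y = lam *: (u * opk v y - y * u).

Let eM := fun b c => etrans (opeM w c b) (addrC _ _).

Lemma inner_e_cross (a : int) : weight_rel q a v w ->
  opkV w u = q ^ (- a) *: u ->
  forall y, opf w (ope v y) - ope v (opf w y)
              = lam *: (opf w u * opk v y - opkV w y * opf w u).
Proof.
move=> [_ _ kf] wu y.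
apply: (inner_cross (mu := right_mul A) eE (p := q ^ (- a))) => // [|b c|z].
- by rewrite expfz_neq0.
- by rewrite [LHS]opfM addrC.
- by rewrite kf scalerA mulVf ?scale1r ?expfz_neq0.
Qed.

Lemma inner_e_comm : weight_rel q 0 v w -> opk w u = u -> ope w u = 0 ->
  forall y, ope w (ope v y) = ope v (ope w y).
Proof.
move=> [_ ke _] wu eu; apply: (inner_comm (mu := right_mul A) eE eM) => // z.
by rewrite ke expr0z scale1r.
Qed.

Lemma inner_e_serre : weight_rel q 2 w w -> weight_rel q (-1) v w ->
  opk v u = q ^+ 2 *: u -> opk w u = q^-1 *: u -> ope w (ope w u) = 0 ->
  u * ope w u = q *: (ope w u * u) ->
  serre_rel q (ope w) (ope v) /\ serre_rel q (ope v) (ope w).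
Proof.
move=> [_ keww _] [kk ke _] vu wu eeu euu.
apply: (inner_serre (mu := right_mul A) q_neq0 eE eM) => // [b c|b c|z|z].
- by rewrite [LHS]opkM.
- by rewrite [LHS]opkM.
- by rewrite ke scalerA mulfV // scale1r.
- by rewrite keww scalerA mulVf ?scale1r ?expf_neq0.
Qed.

End InnerE.
End InnerVertices.

(** * Operators on the quantum space *)
Section QuantumSpaceMaps.
Variables (F : fieldType) (n : nat) (q : F).
Local Notation A := (qspace n q).
Local Notation x := (@qx F n q).
Local Notation cls := (pclass (@qspace_rel F n q)).

Lemma qx_ord (i : 'I_n) : x i.+1 = pgen (@qspace_rel F n q) i.
Proof. by rewrite /qx valK. Qed.

Lemma qxS i (i_n : (i < n)%N) : x i.+1 = pgen (@qspace_rel F n q) (Ordinal i_n).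
Proof. exact: qx_ord (Ordinal i_n). Qed.

Lemma qx_out i : ~~ (1 <= i <= n)%N -> x i = 0.
Proof. by case: i => // i; rewrite /qx; case: insubP => // u ->. Qed.

Lemma qxC i j : (j < i)%N -> x i * x j = q *: (x j * x i).
Proof.
move=> ji; have [i_n|/qx_out->] := boolP (1 <= i <= n)%N; last first.
  by rewrite mul0r mulr0 scaler0.
have [j_n|/qx_out->] := boolP (1 <= j <= n)%N; last first.
  by rewrite mul0r mulr0 scaler0.
case: i j ji i_n j_n => [|i] [|j] // ji i_n j_n.
rewrite (qxS i_n) (qxS j_n).
rewrite /pgen -!pclassM -pclassZ; apply/pclassP/nc_rel.
exact: qspace_comm.
Qed.

Lemma qcst c : cls (NCcst c) = c *: (1 : A).
Proof. by rewrite -pclass1 -pclassZ pclassM pclass1 mulr1. Qed.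

Lemma qspace_ind (P : A -> Prop) :
  P 1 -> (forall i, (1 <= i <= n)%N -> P (x i)) ->
  (forall a b, P a -> P b -> P (a + b)) -> (forall a b, P a -> P b -> P (a * b)) ->
  (forall c a, P a -> P (c *: a)) -> forall a, P a.
Proof.
move=> P1 Px PD PM PZ a; have [t ->] := pclass_surj a.
elim: t => [i|c|t IHt u IHu|t IHt u IHu].
- by rewrite -[cls _]qx_ord; apply: Px; rewrite /= ltn_ord.
- by rewrite qcst; apply: PZ.
- by rewrite pclassD; apply: PD.
- by rewrite pclassM; apply: PM.
Qed.

Lemma qdiag_exists (kappa : nat -> F) :
  {phi : {linear A -> A} | [/\ phi 1 = 1, {morph phi : a b / a * b}
    & forall i, phi (x i) = kappa i *: x i]}.
Proof.
pose v (i : 'I_n) := kappa i.+1 *: x i.+1.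
pose eta : {rmorphism F -> A} := in_alg A.
have inC (c : F) (a : A) : eta c * a = a * eta c.
  by rewrite /= -scalerAl -scalerAr mul1r mulr1.
have rel t u : @qspace_rel F n q t u ->
    nceval eta v t = nceval eta v u.
  case=> i j ji; rewrite /= -!(scalerAl, scalerAr) mul1r qxC ?ltnS //.
  by rewrite !scalerA; congr (_ *: _); ring.
have lin : linear (plift eta v : A -> A).
  move=> c a b; rewrite (pliftD inC rel) (pliftZ inC rel).
  by rewrite -scalerAl mul1r.
pose phi : {linear A -> A} := HB.pack (plift eta v : A -> A)
  (GRing.isLinear.Build F A A *:%R _ lin).
exists phi; split.
- exact: plift1 inC rel.
- exact: pliftM inC rel.
move=> i; have [i_n|/qx_out->] := boolP (1 <= i <= n)%N; last first.
  by rewrite linear0 scaler0.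
case: i i_n => // i i_n; rewrite (qxS i_n).
by rewrite [LHS](plift_gen inC rel) /v qx_ord.
Qed.

Section SkewDerivation.
Variables (phi psi : {linear A -> A}).
Hypotheses (phi1 : phi 1 = 1) (phiM : {morph phi : a b / a * b}).
Hypotheses (psi1 : psi 1 = 1) (psiM : {morph psi : a b / a * b}).

(** The Leibniz rule defines D by recursion on expressions.  Compatibility with
    the congruence that presents A_q(n) comes for free except for the relations
    themselves, for which it is the hypothesis on d. *)
Lemma qskew_exists (d : nat -> A) :
  (forall i j, (1 <= j < i)%N -> (i <= n)%N ->
     phi (x i) * d j + d i * psi (x j)
       = q *: (phi (x j) * d i + d j * psi (x i))) ->
  {D : {linear A -> A} | (forall a b, D (a * b) = phi a * D b + D a * psi b)
    & forall i, (1 <= i <= n)%N -> D (x i) = d i}.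
Proof.
move=> dC.
pose fix D0 (t : ncexpr F 'I_n) : A := match t with
  | NCgen i => d i.+1
  | NCcst c => 0
  | NCadd t u => D0 t + D0 u
  | NCmul t u => phi (cls t) * D0 u + D0 t * psi (cls u)
  end.
have D0cong t u : nccong (@qspace_rel F n q) t u -> D0 t = D0 u.
  have ext t' u' : nccong (@qspace_rel F n q) t' u' -> cls t' = cls u'.
    by move/pclassP.
  elim=> {t u} /=.
  - move=> _ _ [i j ji] /=.
    rewrite mul0r addr0 qcst linearZ /= phi1 -scalerAl mul1r -![cls (NCgen _)]qx_ord.
    by rewrite dC ?ltnS ?ltn_ord.
  - by [].
  - by [].
  - by move=> t u w _ -> _ ->.
  - by move=> t t' u u' _ -> _ ->.
  - by move=> t t' u u' /ext -> -> /ext -> ->.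
  - by move=> t u w; rewrite addrA.
  - by move=> t u; rewrite addrC.
  - by move=> t; rewrite add0r.
  - move=> t; rewrite mul0r addr0 qcst linearZ /= phi1 -scalerAl mul1r.
    by rewrite scaleN1r subrr.
  - move=> t u w; rewrite !pclassM phiM psiM mulrDr mulrDl !mulrA.
    by rewrite addrA.
  - by move=> t; rewrite pclass1 phi1 mul1r mul0r addr0.
  - by move=> t u w; rewrite pclassD linearD /= !mulrDl addrACA.
  - by move=> t u w; rewrite pclassD linearD /= !mulrDr addrACA.
  - by move=> a b; rewrite addr0.
  - by move=> a b; rewrite mulr0 mul0r addr0.
  - move=> c t; rewrite mul0r mulr0 addr0 add0r qcst !linearZ /= phi1 psi1.
    by rewrite -scalerAl -scalerAr mul1r mulr1.
pose D1 (a : A) : A := D0 (prepr a).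
have D1E t : D1 (cls t) = D0 t by apply/D0cong/nccong_repr.
have lin : linear D1.
  move=> c a b; have [t ->] := pclass_surj a; have [u ->] := pclass_surj b.
  rewrite -pclassZ -pclassD !D1E /= mul0r addr0 qcst linearZ /= phi1.
  by rewrite -scalerAl mul1r.
pose D : {linear A -> A} := HB.pack D1 (GRing.isLinear.Build F A A *:%R _ lin).
exists D => [a b|i].
  have [t ->] := pclass_surj a; have [u ->] := pclass_surj b.
  by rewrite -pclassM /= !D1E.
case: i => // i i_n; rewrite (qxS i_n).
exact: D1E.
Qed.

Lemma qskew_eq0 (D : {linear A -> A}) :
  (forall a b, D (a * b) = phi a * D b + D a * psi b) ->
  (forall i, (1 <= i <= n)%N -> D (x i) = 0) -> forall a, D a = 0.
Proof.
move=> DM Dx; elim/qspace_ind => [|//|a b Da Db|a b Da Db|c a Da].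
- have := DM 1 1; rewrite phi1 psi1 !(mulr1, mul1r) => /eqP.
  by rewrite -subr_eq subrr => /eqP.
- by rewrite linearD /= Da Db addr0.
- by rewrite DM Da Db mulr0 mul0r addr0.
- by rewrite linearZ /= Da scaler0.
Qed.

End SkewDerivation.

Lemma qspace_skew_sl2 (kappa : nat -> F) (de df : nat -> A) :
  (forall i, kappa i != 0) ->
  (forall i j, (1 <= j < i)%N -> (i <= n)%N ->
     x i * de j + kappa j *: (de i * x j)
       = q *: (x j * de i + kappa i *: (de j * x i))) ->
  (forall i j, (1 <= j < i)%N -> (i <= n)%N ->
     (kappa i)^-1 *: (x i * df j) + df i * x j
       = q *: ((kappa j)^-1 *: (x j * df i) + df j * x i)) ->
  exists v : skew_sl2 A, forall i, (1 <= i <= n)%N ->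
    [/\ opk v (x i) = kappa i *: x i, ope v (x i) = de i & opf v (x i) = df i].
Proof.
move=> kappa0 deC dfC.
have [k [k1 kM kx]] := qdiag_exists kappa.
have [kV [kV1 kVM kVx]] := qdiag_exists (fun i => (kappa i)^-1).
have idM : {morph (idfun : {linear A -> A}) : a b / a * b} by [].
have [|e eM ex] := @qskew_exists idfun k erefl idM k1 kM de.
  by move=> i j ji i_n; rewrite /= !kx -!scalerAr deC.
have [|f fM fx] := @qskew_exists kV idfun kV1 kVM erefl idM df.
  by move=> i j ji i_n; rewrite /= !kVx -!scalerAl dfC.
have kK : cancel k kV.
  elim/qspace_ind => [|i _|a b Ha Hb|a b Ha Hb|c a Ha].
  - by rewrite k1 kV1.
  - by rewrite kx linearZ /= kVx scalerA divff // scale1r.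
  - by rewrite !linearD /= Ha Hb.
  - by rewrite kM kVM Ha Hb.
  - by rewrite !linearZ /= Ha.
have kVK : cancel kV k.
  elim/qspace_ind => [|i _|a b Ha Hb|a b Ha Hb|c a Ha].
  - by rewrite kV1 k1.
  - by rewrite kVx linearZ /= kx scalerA mulVf // scale1r.
  - by rewrite !linearD /= Ha Hb.
  - by rewrite kVM kM Ha Hb.
  - by rewrite !linearZ /= Ha.
exists (SkewSl2 k1 kM kK kVK eM fM) => i i_n /=.
by rewrite kx ex // fx.
Qed.

End QuantumSpaceMaps.

(** * Relations checked on generators *)
Section QuantumSpaceRelations.
Variables (F : fieldType) (n : nat) (q : F).
Hypothesis q_neq0 : q != 0.
Local Notation A := (qspace n q).
Local Notation x := (@qx F n q).
Implicit Types (v w : skew_sl2 A) (a : int).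

Lemma qskew_ext (phi psi D D' : {linear A -> A}) :
  phi 1 = 1 -> psi 1 = 1 ->
  (forall b c, D (b * c) = phi b * D c + D b * psi c) ->
  (forall b c, D' (b * c) = phi b * D' c + D' b * psi c) ->
  (forall i, D (x i) = D' (x i)) -> forall y, D y = D' y.
Proof.
move=> phi1 psi1 DM D'M DD' y; apply/eqP; rewrite -subr_eq0; apply/eqP.
apply: (@qskew_eq0 _ _ _ phi psi phi1 psi1 (D \- D')) => [b c|i i_n] /=.
  by rewrite DM D'M opprD addrACA mulrBr mulrBl.
by rewrite DD' subrr.
Qed.

Lemma qmorph_ext (phi psi : {linear A -> A}) :
  phi 1 = psi 1 -> {morph phi : b c / b * c} -> {morph psi : b c / b * c} ->
  (forall i, phi (x i) = psi (x i)) -> forall y, phi y = psi y.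
Proof.
move=> e1 phiM psiM ex; elim/qspace_ind => [|i _|b c Hb Hc|b c Hb Hc|c b Hb] //.
- by rewrite !linearD /= Hb Hc.
- by rewrite phiM psiM Hb Hc.
- by rewrite !linearZ /= Hb.
Qed.

Lemma weight_rel_gen a v w :
  (forall i, opk v (opk w (x i)) = opk w (opk v (x i))) ->
  (forall i, opk v (ope w (x i)) = q ^ a *: ope w (opk v (x i))) ->
  (forall i, opk v (opf w (x i)) = q ^ (- a) *: opf w (opk v (x i))) ->
  weight_rel q a v w.
Proof.
move=> kk ke kf.
have kkT y : opk v (opk w y) = opk w (opk v y).
  apply: (qmorph_ext (phi := opk v \o opk w) (psi := opk w \o opk v)) => //=.
  - by rewrite !opk1.
  - by move=> b c /=; rewrite !opkM.
  - by move=> b c /=; rewrite !opkM.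
have kkVT y : opkV w (opk v y) = opk v (opkV w y).
  by apply: (canLR (opkK w)); rewrite -kkT opkVK.
split=> y; first exact: kkT.
- apply: (@qskew_ext (opk v) (opk v \o opk w) (opk v \o ope w)
    (q ^ a \*: (ope w \o opk v))) => [||b c|b c|//] /=.
  + exact: opk1.
  + by rewrite !opk1.
  + by rewrite opeM linearD /= !opkM.
  + by rewrite opkM opeM scalerDr -scalerAl -scalerAr kkT.
- apply: (@qskew_ext (opk v \o opkV w) (opk v) (opk v \o opf w)
    (q ^ (- a) \*: (opf w \o opk v))) => [||b c|b c|//] /=.
  + by rewrite opkV1 opk1.
  + exact: opk1.
  + by rewrite opfM linearD /= !opkM.
  + by rewrite opkM opfM scalerDr -scalerAl -scalerAr kkVT.
Qed.

(** The two mixed terms of the Leibniz rule of [e_v, f_w] carry the same power of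
    q, by the weight relations, and cancel. *)
Lemma opcomm_ef_skew a v w : weight_rel q a v w -> weight_rel q a w v ->
  forall b c, opcomm (ope v) (opf w) (b * c) =
    opkV w b * opcomm (ope v) (opf w) c + opcomm (ope v) (opf w) b * opk v c.
Proof.
move=> vw wv b c /=; have [_ _ kf] := vw.
rewrite opfM opeM !linearD /= !opeM !opfM kf (weight_kVe q_neq0 wv).
rewrite -scalerAl -scalerAr !mulrBr !mulrBl !opprD.
rewrite [LHS](AC ((2*2)*(2*2)) (((1*5)*(4*8))*((2*7)*(3*6)))) /=.
by rewrite !subrr !addr0.
Qed.

Lemma cross_rel_gen a v w : weight_rel q a v w -> weight_rel q a w v ->
  (forall i, ope v (opf w (x i)) = opf w (ope v (x i))) -> cross_rel v w.
Proof.
move=> vw wv ef y; apply/eqP; rewrite -subr_eq0; apply/eqP.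
apply: (@qskew_eq0 _ _ _ (opkV w) (opk v) (opkV1 w) (opk1 v)
  (opcomm (ope v) (opf w))) => [|i _] /=.
  exact: opcomm_ef_skew vw wv.
by rewrite ef subrr.
Qed.

Lemma vertex_rel_gen v : weight_rel q 2 v v ->
  (forall i, ope v (opf v (x i)) - opf v (ope v (x i))
               = (q - q^-1)^-1 *: (opk v (x i) - opkV v (x i))) ->
  vertex_rel q v.
Proof.
move=> vv ef; split=> // y.
apply: (@qskew_ext (opkV v) (opk v) (opcomm (ope v) (opf v))
  ((q - q^-1)^-1 \*: (opk v \- opkV v))) => [|||b c|//] /=.
- exact: opkV1.
- exact: opk1.
- exact: (opcomm_ef_skew vv vv).
- rewrite opkM opkVM -scalerAl -scalerAr -scalerDr mulrBr mulrBl.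
  by rewrite [X in _ = _ *: X]addrC addrA subrK.
Qed.

Lemma comm_ee_gen v w : weight_rel q 0 v w -> weight_rel q 0 w v ->
  (forall i, ope v (ope w (x i)) = ope w (ope v (x i))) ->
  forall y, ope v (ope w y) = ope w (ope v y).
Proof.
move=> [kk ke _] [_ ke' _] ee y; apply/eqP; rewrite -subr_eq0; apply/eqP.
apply: (@qskew_eq0 _ _ _ idfun (opk v \o opk w) erefl _
  (opcomm (ope v) (ope w))) => [/=|b c|i i_n] /=.
- by rewrite !opk1.
- rewrite !opeM !linearD /= !opeM ke ke' !expr0z !scale1r kk.
  rewrite mulrBr mulrBl !opprD.
  rewrite [LHS](AC ((2*2)*(2*2)) (((1*5)*(4*8))*((2*7)*(3*6)))) /=.
  by rewrite !subrr !addr0.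
- by rewrite ee subrr.
Qed.

Lemma comm_ff_gen v w : weight_rel q 0 v w -> weight_rel q 0 w v ->
  (forall i, opf v (opf w (x i)) = opf w (opf v (x i))) ->
  forall y, opf v (opf w y) = opf w (opf v y).
Proof.
move=> vw wv ff y; apply/eqP; rewrite -subr_eq0; apply/eqP.
apply: (@qskew_eq0 _ _ _ (opkV v \o opkV w) idfun _ erefl
  (opcomm (opf v) (opf w))) => [/=|b c|i i_n] /=.
- by rewrite !opkV1.
- rewrite !opfM !linearD /= !opfM (weight_kVf q_neq0 vw) (weight_kVf q_neq0 wv).
  rewrite !expr0z !scale1r (weight_kVkV vw).
  rewrite mulrBr mulrBl !opprD.
  rewrite [LHS](AC ((2*2)*(2*2)) (((1*5)*(4*8))*((2*7)*(3*6)))) /=.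
  by rewrite !subrr !addr0.
- by rewrite ff subrr.
Qed.

Lemma serre_e_gen v w : weight_rel q 2 v v -> weight_rel q (-1) v w ->
  weight_rel q (-1) w v -> (forall i, opserre q (ope v) (ope w) (x i) = 0) ->
  serre_rel q (ope v) (ope w).
Proof.
move=> [_ ke _] [kk ke' _] [_ ke'' _] se y.
apply: (@qskew_eq0 _ _ _ idfun (opk v \o opk v \o opk w) erefl _
  (opserre q (ope v) (ope w))) => [/=|b c|i i_n]; last exact: se.
  by rewrite !opk1.
apply: (@opserre_skew _ _ _ q_neq0 (left_mul A) (opk v) (opk w)) => //.
- exact: opeM.
- exact: opeM.
Qed.

Lemma serre_f_gen v w : weight_rel q 2 v v -> weight_rel q (-1) v w ->
  weight_rel q (-1) w v -> (forall i, opserre q (opf v) (opf w) (x i) = 0) ->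
  serre_rel q (opf v) (opf w).
Proof.
move=> vv vw wv sf y.
apply: (@qskew_eq0 _ _ _ (opkV v \o opkV v \o opkV w) idfun _ erefl
  (opserre q (opf v) (opf w))) => [/=|b c|i i_n]; last exact: sf.
  by rewrite !opkV1.
rewrite addrC.
apply: (@opserre_skew _ _ _ q_neq0 (right_mul A) (opkV v) (opkV w))
  => [b' c'|b' c'|z|z|z|z].
- by rewrite [LHS]opfM addrC.
- by rewrite [LHS]opfM addrC.
- by rewrite (weight_kVkV vw).
- exact: weight_kVf q_neq0 vv z.
- exact: weight_kVf q_neq0 vw z.
- exact: weight_kVf q_neq0 wv z.
Qed.

End QuantumSpaceRelations.

(** * The types of actions *)
Section ActionTypes.
Variables (F : fieldType) (n : nat) (q : F).
Local Notation A := (qspace n q).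
Local Notation x := (@qx F n q).
Implicit Types (v w : skew_sl2 A) (t : action_type) (sg : nat -> bool) (c d : F).

Definition type_scal t sg (i : nat) : F :=
  match t with
  | TypeD => (-1) ^+ sg i
  | TypeA j => if (i < j)%N then q else if i == j then q ^- 2 else q^-1
  | TypeB j => if (i < j)%N then q else if i == j then q ^+ 2 else q^-1
  | TypeC j => if i == j then q else if i == j.+1 then q^-1 else 1
  end.

Definition type_e t c (i : nat) : A :=
  match t with
  | TypeD => 0
  | TypeA j => if i == j then c%:A else 0
  | TypeB j => if (i < j)%N then - q * c^-1 *: (x i * x j)
               else if i == j then - q * c^-1 *: x j ^+ 2
               else c^-1 *: (x j * x i)
  | TypeC j => if i == j.+1 then c *: x j else 0
  end.

Definition type_f t c (i : nat) : A :=
  match t with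
  | TypeD => 0
  | TypeA j => if (i < j)%N then c^-1 *: (x i * x j)
               else if i == j then - q * c^-1 *: x j ^+ 2
               else - q * c^-1 *: (x j * x i)
  | TypeB j => if i == j then c%:A else 0
  | TypeC j => if i == j then c^-1 *: x j.+1 else 0
  end.

Definition type_ok t : bool :=
  match t with
  | TypeD => true
  | TypeA j | TypeB j => (1 <= j <= n)%N
  | TypeC j => (1 <= j < n)%N
  end.

(** No bound on i is needed: outside the range of indices x i is 0, and the
    prescribed values vanish too ([type_out]). *)
Definition has_type t sg c v := forall i,
  [/\ opk v (x i) = type_scal t sg i *: x i, ope v (x i) = type_e t c i
    & opf v (x i) = type_f t c i].

Lemma has_type_acts_as t sg c v : has_type t sg c v ->
  acts_as t sg c (opk v) (ope v) (opf v).
Proof. by move=> tv i _; have [] := tv i; case: t {tv}. Qed.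

Lemma type_out t c i : type_ok t -> ~~ (1 <= i <= n)%N ->
  type_e t c i = 0 /\ type_f t c i = 0.
Proof.
case: t => [|j|j|j] ok i_n; rewrite /type_e /type_f ?(qx_out q i_n) //.
- rewrite mul0r mulr0 scaler0; case: eqVneq i_n => [->|]; first by move/negP/(_ ok).
  by rewrite scaler0 if_same.
- rewrite mul0r mulr0 scaler0; case: eqVneq i_n => [->|]; first by move/negP/(_ ok).
  by rewrite scaler0 if_same.
- have /= /andP[j_gt0 j_n] := ok.
  by case: eqVneq => [?|_]; case: eqVneq => [?|_] //; exfalso; lia.
Qed.

Hypothesis q_neq0 : q != 0.

Lemma type_scal_neq0 t sg i : type_scal t sg i != 0.
Proof.
by case: t => [|j|j|j]; rewrite /type_scal ?signr_eq0 //;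
  do ?case: ifP => // _; rewrite ?invr_eq0 ?expf_eq0 ?oner_eq0.
Qed.

Hypothesis qV_neq : q - q^-1 != 0.

(** The coefficient of the inner operator in types A and B with parameter c. *)
Definition inner_coef c := (c * (q^-1 - q))^-1.

Lemma inner_coefE c : c != 0 ->
  c^-1 = inner_coef c * (q^-1 - q) /\ - q * c^-1 = inner_coef c * (q ^+ 2 - 1).
Proof.
move=> c0; have qq0 : 1 - q * q != 0.
  apply: contraNneq qV_neq => qq; apply/eqP/(mulfI q_neq0).
  by rewrite mulr0 mulrBr mulfV // -(opprB 1) qq oppr0.
by split; rewrite /inner_coef; field; rewrite mulNr q_neq0 qq0 c0.
Qed.

Lemma type_fA_inner j sg c i : c != 0 -> type_f (TypeA j) c i =
  inner_coef c *: ((type_scal (TypeA j) sg i)^-1 *: (x i * x j) - x j * x i).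
Proof.
move=> c0; have [c1 c2] := inner_coefE c0; rewrite /type_f /type_scal c2 c1.
have [ij|ji|->] := ltngtP i j.
- rewrite (qxC n q ij) -scalerBl scalerA; congr (_ *: _); ring.
- rewrite (qxC n q ji) scalerA invrK -{3}[x j * x i]scale1r -scalerBl scalerA.
  by congr (_ *: _); ring.
- by rewrite (expr2 (x j)) invrK -{3}[x j * x j]scale1r -scalerBl scalerA.
Qed.

Lemma type_eB_inner j sg c i : c != 0 -> type_e (TypeB j) c i =
  inner_coef c *: (type_scal (TypeB j) sg i *: (x j * x i) - x i * x j).
Proof.
move=> c0; have [c1 c2] := inner_coefE c0; rewrite /type_e /type_scal c2 c1.
have [ij|ji|->] := ltngtP i j.
- rewrite (qxC n q ij) scalerA -{3}[x i * x j]scale1r -scalerBl scalerA.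
  by congr (_ *: _); ring.
- by rewrite (qxC n q ji) -scalerBl scalerA.
- by rewrite (expr2 (x j)) -{3}[x j * x j]scale1r -scalerBl scalerA.
Qed.

(** The values of an inner operator respect x_i x_j = q x_j x_i, whatever u is:
    each side is the value of that operator on a monomial of degree 2. *)
Lemma inner_skew_f (u : A) c (kappa : nat -> F) (d : nat -> A) :
  (forall i, d i = c *: ((kappa i)^-1 *: (x i * u) - u * x i)) ->
  forall i j, (j < i)%N ->
    (kappa i)^-1 *: (x i * d j) + d i * x j
      = q *: ((kappa j)^-1 *: (x j * d i) + d j * x i).
Proof.
move=> dE i j ji.
have prod (a b : nat) : (kappa a)^-1 *: (x a * d b) + d a * x b =
    c *: (((kappa a)^-1 / kappa b) *: (x a * x b * u) - u * (x a * x b)).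
  rewrite !dE -scalerAr -[(_ *: _) * x b]scalerAl scalerA [_ * c]mulrC.
  rewrite -[(c * _) *: _]scalerA -scalerDr; congr (_ *: _).
  rewrite mulrBr mulrBl -scalerAr -scalerAl scalerBr scalerA !mulrA.
  by rewrite addrA subrK.
rewrite !prod (qxC n q ji) -scalerAl -scalerAr [RHS]scalerA [q * c]mulrC.
rewrite -[RHS]scalerA; congr (_ *: _); rewrite scalerBr !scalerA.
by congr (_ *: _ - _); rewrite mulrC; congr (_ * _); exact: mulrC.
Qed.

Lemma inner_skew_e (u : A) c (kappa : nat -> F) (d : nat -> A) :
  (forall i, d i = c *: (kappa i *: (u * x i) - x i * u)) ->
  forall i j, (j < i)%N ->
    x i * d j + kappa j *: (d i * x j)
      = q *: (x j * d i + kappa i *: (d j * x i)).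
Proof.
move=> dE i j ji.
have prod (a b : nat) : x a * d b + kappa b *: (d a * x b) =
    c *: ((kappa a * kappa b) *: (u * (x a * x b)) - x a * x b * u).
  rewrite !dE -scalerAr -[(_ *: _) * x b]scalerAl scalerA [_ * c]mulrC.
  rewrite -[(c * _) *: _]scalerA -scalerDr; congr (_ *: _).
  rewrite mulrBr mulrBl -scalerAr -scalerAl scalerBr scalerA !mulrA.
  by rewrite [kappa b * _]mulrC [LHS]addrC addrA subrK.
rewrite !prod (qxC n q ji) -scalerAl -scalerAr [RHS]scalerA [q * c]mulrC.
rewrite -[RHS]scalerA; congr (_ *: _); rewrite scalerBr !scalerA.
by congr (_ *: _ - _); rewrite mulrC; congr (_ * _); exact: mulrC.
Qed.

Lemma simple_skew_e t sg c i j : (if t is TypeB _ then false else true) ->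
  (j < i)%N ->
  x i * type_e t c j + type_scal t sg j *: (type_e t c i * x j)
    = q *: (x j * type_e t c i + type_scal t sg i *: (type_e t c j * x i)).
Proof.
case: t => [|l|l|l] //= _ ji.
- by rewrite ?(mulr0, mul0r, scaler0, addr0).
- have [il|li|il] := ltngtP i l; have [jl|lj|jl] := ltngtP j l; try lia;
    rewrite ?(mulr0, mul0r, scaler0, addr0, add0r) //.
  + by rewrite -scalerAl -scalerAr mul1r mulr1 !scalerA divff // mul1r.
  + by rewrite -scalerAl -scalerAr mul1r mulr1.
- have [il|/negPf il] := eqVneq i l.+1.
    have -> : (j == l.+1) = false by lia.
    rewrite mulr0 mul0r scaler0 addr0 add0r -scalerAl -scalerAr.
    have [->|/negPf jl] := eqVneq j l; first by [].
    by rewrite scale1r (qxC n q (_ : j < l)%N) ?scalerA 1?mulrC //; lia.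
  have [jl|/negPf jl] := eqVneq j l.+1; last first.
    by rewrite ?(mulr0, mul0r, scaler0, addr0).
  have -> : (i == l) = false by lia.
  rewrite mulr0 mul0r scaler0 addr0 add0r scale1r -scalerAl -scalerAr.
  by rewrite (qxC n q (_ : l < i)%N) ?scalerA 1?mulrC //; lia.
Qed.

Lemma simple_skew_f t sg c i j : (if t is TypeA _ then false else true) ->
  (j < i)%N ->
  (type_scal t sg i)^-1 *: (x i * type_f t c j) + type_f t c i * x j
    = q *: ((type_scal t sg j)^-1 *: (x j * type_f t c i) + type_f t c j * x i).
Proof.
case: t => [|l|l|l] //= _ ji.
- by rewrite ?(mulr0, mul0r, scaler0, addr0).
- have [il|li|il] := ltngtP i l; have [jl|lj|jl] := ltngtP j l; try lia;
    rewrite ?(mulr0, mul0r, scaler0, addr0, add0r) //.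
  + by rewrite invrK -scalerAl -scalerAr mul1r mulr1.
  + by rewrite -scalerAl -scalerAr mul1r mulr1 !scalerA divff // mul1r.
- have [il|/negPf il] := eqVneq i l.
    have -> : (j == l) = false by lia.
    have -> : (j == l.+1) = false by lia.
    rewrite invr1 mulr0 mul0r scaler0 addr0 add0r -scalerAl -scalerAr scale1r.
    by rewrite (qxC n q (_ : j < l.+1)%N) ?scalerA 1?mulrC //; lia.
  have [jl|/negPf jl] := eqVneq j l; last first.
    by rewrite ?(mulr0, mul0r, scaler0, addr0).
  rewrite mulr0 mul0r scaler0 addr0 add0r -scalerAl -scalerAr.
  have [->|/negPf il1] := eqVneq i l.+1; first by rewrite invrK.
  by rewrite invr1 scale1r (qxC n q (_ : l.+1 < i)%N) ?scalerA 1?mulrC //; lia.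
Qed.

Lemma type_vertex t sg c : type_ok t -> c != 0 -> exists v, has_type t sg c v.
Proof.
move=> ok c0.
have [i j /andP[_ ji] _|i j /andP[_ ji] _|v vP] :=
    @qspace_skew_sl2 F n q _ (type_e t c) (type_f t c) (type_scal_neq0 t sg).
- case: t ok => [|l|l|l] _; try exact: simple_skew_e.
  by apply: inner_skew_e ji => k; apply: type_eB_inner.
- case: t ok => [|l|l|l] _; try exact: simple_skew_f.
  by apply: inner_skew_f ji => k; apply: type_fA_inner.
exists v => i; have [/vP//|i_n] := boolP (1 <= i <= n)%N.
by have [-> ->] := type_out c ok i_n; rewrite (qx_out q i_n) !linear0.
Qed.

Lemma has_type_kV t sg c v : has_type t sg c v ->
  forall i, opkV v (x i) = (type_scal t sg i)^-1 *: x i.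
Proof.
move=> tv i; apply: (canLR (opkK v)); rewrite linearZ /=; have [-> _ _] := tv i.
by rewrite scalerA mulVf ?scale1r // type_scal_neq0.
Qed.

Lemma typeA_inner j sg c v : c != 0 -> has_type (TypeA j) sg c v ->
  forall y, opf v y = inner_coef c *: (opkV v y * x j - x j * y).
Proof.
move=> c0 tv.
pose D : {linear A -> A} :=
  inner_coef c \*: ((x j \o* opkV v) \- (x j \*o idfun)).
apply: (@qskew_ext _ _ _ (opkV v) idfun _ D) => [||a b|a b|i] //=.
- exact: opkV1.
- exact: opfM.
- rewrite opkVM -scalerAr -scalerAl -scalerDr mulrBr mulrBl !mulrA.
  by rewrite addrA subrK.
- have [_ _ ->] := tv i; rewrite (has_type_kV tv) -scalerAl.
  exact: type_fA_inner.
Qed.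

Lemma typeB_inner j sg c v : c != 0 -> has_type (TypeB j) sg c v ->
  forall y, ope v y = inner_coef c *: (x j * opk v y - y * x j).
Proof.
move=> c0 tv.
pose D : {linear A -> A} :=
  inner_coef c \*: ((x j \*o opk v) \- (x j \o* idfun)).
apply: (@qskew_ext _ _ _ idfun (opk v) _ D) => [||a b|a b|i] //=.
- exact: opk1.
- exact: opeM.
- rewrite opkM -scalerAr -scalerAl -scalerDr mulrBr mulrBl !mulrA.
  by congr (_ *: _); rewrite [RHS]addrC addrA subrK.
- have [-> -> _] := tv i; rewrite -scalerAr.
  exact: type_eB_inner.
Qed.

End ActionTypes.

(** * Relations at one vertex *)
Section TypeRelations.
Variables (F : fieldType) (n : nat) (q : F).
Hypothesis q_neq0 : q != 0.
Local Notation A := (qspace n q).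
Local Notation x := (@qx F n q).
Local Arguments qx F n q i : simpl never.
Implicit Types (v w : skew_sl2 A) (t : action_type) (sg : nat -> bool) (c d : F).

(** If k acts on each x i by kappa i, then k e k^-1 = w e and k f k^-1 = w^-1 f for
    the operators e and f of type t, where w is this scalar. *)
Definition type_weight t (kappa : nat -> F) : F :=
  match t with
  | TypeD => 1
  | TypeA j => (kappa j)^-1
  | TypeB j => kappa j
  | TypeC j => kappa j / kappa j.+1
  end.

Lemma weight_rel_types (a : int) t sg c v t' sg' c' w :
  has_type t sg c v -> has_type t' sg' c' w ->
  type_weight t' (type_scal q t sg) = q ^ a \/ t' = TypeD -> weight_rel q a v w.
Proof.
move=> tv tw wt; pose kappa := type_scal q t sg.
have kv i : opk v (x i) = kappa i *: x i by have [] := tv i.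
have kw i : opk w (x i) = type_scal q t' sg' i *: x i by have [] := tw i.
have kappa0 i : kappa i != 0 by apply: type_scal_neq0.
apply: weight_rel_gen => // i.
- by rewrite kw kv !linearZ /= kw kv !scalerA mulrC.
- rewrite kv linearZ /= scalerA; have [_ -> _] := tw i.
  case: wt => [<-|->]; last by rewrite /= linear0 scaler0.
  case: t' {tw kw} => [|j|j|j] /=.
  + by rewrite linear0 scaler0.
  + case: eqVneq => [->|_]; last by rewrite linear0 scaler0.
    by rewrite linearZ /= opk1 mulVf // scale1r.
  + by case: ltngtP => [_|_|->]; rewrite linearZ /= ?expr2 opkM !kv -scalerAl
      -scalerAr !scalerA; congr (_ *: _); rewrite /kappa; ring.
  + case: eqVneq => [->|_]; last by rewrite linear0 scaler0.
    rewrite linearZ /= kv !scalerA; congr (_ *: _); rewrite -/kappa.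
    by rewrite divfK // mulrC.
- rewrite kv linearZ /= scalerA; have [_ _ ->] := tw i; rewrite -invr_expz.
  case: wt => [<-|->]; last by rewrite /= linear0 scaler0.
  case: t' {tw kw} => [|j|j|j] /=.
  + by rewrite linear0 scaler0.
  + rewrite invrK -/kappa.
    by case: ltngtP => [_|_|->]; rewrite linearZ /= ?expr2 opkM !kv -scalerAl
      -scalerAr !scalerA; congr (_ *: _); ring.
  + case: eqVneq => [->|_]; last by rewrite linear0 scaler0.
    by rewrite linearZ /= opk1 -/kappa mulVf // scale1r.
  + case: eqVneq => [->|_]; last by rewrite linear0 scaler0.
    rewrite linearZ /= kv !scalerA; congr (_ *: _); rewrite -/kappa.
    by rewrite invf_div divfK // mulrC.
Qed.

Lemma serre_words (e f : {linear A -> A}) y :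
  e (e (f y)) = 0 -> e (f (e y)) = 0 -> f (e (e y)) = 0 -> opserre q e f y = 0.
Proof. by move=> h1 h2 h3; rewrite /opserre /= h1 h2 h3 scaler0 subrr addr0. Qed.

Lemma weight_rel_self t sg c v : has_type t sg c v -> weight_rel q 2 v v.
Proof.
move=> tv; apply: (weight_rel_types tv tv).
case: t {tv} => [|j|j|j]; [by right|left|left|left] => /=.
- by rewrite ltnn eqxx invrK.
- by rewrite ltnn eqxx.
- by rewrite !eqxx (_ : (j.+1 == j) = false) ?invrK //; lia.
Qed.

Hypothesis qV_neq : q - q^-1 != 0.

Lemma type_vertex_rel t sg c v : c != 0 -> has_type t sg c v -> vertex_rel q v.
Proof.
move=> c0 tv; have wt := weight_rel_self tv; split=> // y.
have lamc : inner_coef q c * c = - (q - q^-1)^-1.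
  rewrite /inner_coef invfM mulrAC mulVf // mul1r -invrN; congr (_^-1); ring.
case: t tv => [|j|j|j] tv.
- have [i|_ efy] := vertex_rel_gen q_neq0 wt; last exact: efy.
  have [-> -> ->] := tv i; rewrite (has_type_kV q_neq0 tv) !linear0 /=.
  by rewrite addr0 invr_sign subrr scaler0.
- have [_ eu _] := tv j; have [ku _ _] := tv j.
  rewrite (inner_f_cross q_neq0 (typeA_inner q_neq0 qV_neq c0 tv) wt); last first.
    by rewrite ku /= ltnn eqxx.
  rewrite eu /= eqxx -scalerAl -scalerAr mul1r mulr1 -scalerBr scalerA lamc.
  by rewrite scaleNr -scalerN opprB.
- have [_ _ fu] := tv j; have ku := has_type_kV q_neq0 tv j.
  rewrite -[LHS]opprB (inner_e_cross q_neq0 (typeB_inner q_neq0 qV_neq c0 tv) wt).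
    rewrite fu /= eqxx -scalerAl -scalerAr mul1r mulr1 -scalerBr scalerA lamc.
    by rewrite scaleNr opprK.
  by rewrite ku /= ltnn eqxx.
- have [i|_ efy] := vertex_rel_gen q_neq0 wt; last exact: efy.
  have eE k : ope v (x k) = type_e n q (TypeC j) c k by have [] := tv k.
  have fE k : opf v (x k) = type_f n q (TypeC j) c k by have [] := tv k.
  have [-> _ _] := tv i; rewrite (has_type_kV q_neq0 tv) eE fE /= -scalerBl scalerA.
  have j1j : (j.+1 == j) = false by lia.
  have jj1 : (j == j.+1) = false by lia.
  have [->|ij] := eqVneq i j.
    rewrite jj1 linear0 linearZ /= eE /= eqxx scalerA mulVf // scale1r subr0.
    by rewrite mulVf // scale1r.
  have [->|ij1] := eqVneq i j.+1.
    rewrite linear0 linearZ /= fE /= eqxx scalerA mulfV // scale1r sub0r invrK.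
    by rewrite -(opprB q) mulrN mulVf // scaleN1r.
  by rewrite !linear0 invr1 subrr mulr0 scale0r addr0.
Qed.

Definition related (a : int) t t' := forall sg c v sg' c' w,
  c != 0 -> c' != 0 -> has_type t sg c v -> has_type t' sg' c' w ->
  pair_rel q a v w.

Lemma typeD_zero sg c v : has_type TypeD sg c v ->
  (forall y, ope v y = 0) /\ (forall y, opf v y = 0).
Proof.
move=> tv; split.
  apply: (qskew_eq0 (phi := idfun) erefl (opk1 v) (opeM v)) => i _.
  by have [] := tv i.
apply: (qskew_eq0 (psi := idfun) (opkV1 v) erefl (opfM v)) => i _.
by have [] := tv i.
Qed.

Lemma related_DD (a : int) : related a TypeD TypeD.
Proof.
move=> sg c v sg' c' w c0 c'0 tv tw.
have [ev fv] := typeD_zero tv; have [ew fw] := typeD_zero tw.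
split=> [||_|_].
- split; first by apply: (weight_rel_types tv tw); right.
  by apply: (weight_rel_types tw tv); right.
- by split=> y; rewrite !(ev, fv, ew, fw).
- by split; split=> y; apply: serre_words; rewrite !(ev, fv, ew, fw).
- by split=> y; rewrite !(ev, fv, ew, fw).
Qed.

End TypeRelations.

(** * Relations between two vertices *)
Section PairRelations.
Variables (F : fieldType) (n : nat) (q : F).
Hypothesis q_neq0 : q != 0.
Hypothesis qV_neq : q - q^-1 != 0.
Local Notation A := (qspace n q).
Local Notation x := (@qx F n q).
Local Arguments qx F n q i : simpl never.
Implicit Types (v w : skew_sl2 A) (t : action_type) (sg : nat -> bool) (c d : F).

(** Comparisons of indices are settled by arithmetic or, failing that, by cases
    on an equality.  [scalar] then closes an identity between powers of q, and
    [evaluate] computes an operator on a multiple of a generator. *)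
Ltac decide_if :=
  match goal with |- context [match ?b with true => ?s | false => ?s' end] =>
  first [ rewrite (@ifT _ b s s'); [|lia] | rewrite (@ifF _ b s s'); [|lia]
        | match b with ?i == ?j =>
            let eij := fresh in
            have [eij|eij] := eqVneq i j; [rewrite ?eij|]; try (exfalso; lia)
          end ] end.

Ltac scalar := rewrite /type_weight /type_scal; repeat decide_if;
  rewrite ?(opprK, oppr0, exprN1, expr1z, expr0z, invr1, divr1);
  first [done | by field | by field; rewrite oner_neq0 andbT].

Ltac evaluate rules := repeat first [progress rewrite ?rules | decide_if]; try done.

Let eZ v c y : ope v (c *: y) = c *: ope v y. Proof. exact: linearZ. Qed.
Let fZ v c y : opf v (c *: y) = c *: opf v y. Proof. exact: linearZ. Qed.
Let e0 v : ope v 0 = 0. Proof. exact: linear0. Qed.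
Let f0 v : opf v 0 = 0. Proof. exact: linear0. Qed.
Let opE := (eZ, fZ, e0, f0, @ope1 F A, @opf1 F A, @scaler0 F A).

(** The shape of the operators that are not inner: y is a scalar or a multiple of
    a generator, hence a relation is settled by its effect on y. *)
Definition sends (e : {linear A -> A}) (s : nat) (y : A) :=
  forall k, e (x k) = if k == s then y else 0.

Lemma sends_comm (e f : {linear A -> A}) s y s' z : sends e s y -> sends f s' z ->
  e z = 0 -> f y = 0 -> forall k, e (f (x k)) = f (e (x k)).
Proof.
move=> es ft ez fy k; rewrite es ft.
by case: ifP => _; case: ifP => _; rewrite ?(ez, fy, linear0).
Qed.

Definition serre_on_gens (e f : {linear A -> A}) :=
  forall k, opserre q e f (x k) = 0 /\ opserre q f e (x k) = 0.

(** On generators, e o f is the only word of length two in e and f that may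
    survive, and no word of length three does. *)
Lemma sends_serre (e f : {linear A -> A}) s y s' z : sends e s y -> sends f s' z ->
  e y = 0 -> f y = 0 -> f z = 0 -> e (e z) = 0 -> f (e z) = 0 ->
  serre_on_gens e f.
Proof.
move=> es ft ey fy fz eez fez k.
by split; apply: serre_words; rewrite !(es, ft); case: ifP => _;
  rewrite ?(ey, fy, fz, eez, fez, linear0).
Qed.

(** e_A kills 1 and every generator but x_i; f_A is inner for u = x_i, and f_C
    sends x_i to a multiple of x_(i+1) if i = j, and to 0 otherwise. *)
Lemma related_AC (a : int) i j : (1 <= i <= j)%N -> (j < n)%N ->
  a = (if i == j then -1 else 0) -> @related F n q a (TypeA i) (TypeC j).
Proof.
move=> /andP[i_gt0 ij] j_n aE sg c v sg' c' w c0 c'0 tv tw.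
have vw : weight_rel q a v w.
  apply: (weight_rel_types q_neq0 tv tw); left.
  by rewrite aE; case: eqVneq => ?; scalar.
have wv : weight_rel q a w v.
  apply: (weight_rel_types q_neq0 tw tv); left.
  by rewrite aE; case: eqVneq => ?; scalar.
have vv := weight_rel_self q_neq0 tv; have ww := weight_rel_self q_neq0 tw.
have ev k : ope v (x k) = if k == i then c%:A else 0 by have [] := tv k.
have ew k : ope w (x k) = if k == j.+1 then c' *: x j else 0 by have [] := tw k.
have fw k : opf w (x k) = if k == j then c'^-1 *: x j.+1 else 0 by have [] := tw k.
have fv := typeA_inner q_neq0 qV_neq c0 tv.
have kw k : opk w (x k) = type_scal q (TypeC j) sg' k *: x k by have [] := tw k.
have kVv := has_type_kV q_neq0 tv; have kVw := has_type_kV q_neq0 tw.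
split=> //.
- split.
    apply: (cross_rel_gen q_neq0 vw wv).
    by apply: (sends_comm ev fw); evaluate (ev, fw, opE).
  move=> y; apply/eqP; rewrite -subr_eq0 (inner_f_cross q_neq0 fv vw).
    have -> : ope w (x i) = 0 by evaluate ew.
    by rewrite mulr0 mul0r subrr scaler0.
  by rewrite kw aE; congr (_ *: _); case: eqVneq => ?; scalar.
- move=> am; have ji : j = i by move: aE; rewrite am; case: eqVneq.
  rewrite am in vw wv; split.
    have sr : serre_on_gens (ope v) (ope w)
      by apply: (sends_serre ev ew); evaluate (ev, ew, opE).
    by split; apply: serre_e_gen => // k; have [] := sr k.
  have [| | | |s1 s2] := inner_f_serre q_neq0 fv ww vw; last by split.
  + by rewrite kVv; congr (_ *: _); scalar.
  + by rewrite kVw; congr (_ *: _); scalar.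
  + by evaluate (fw, opE).
  + rewrite fw ji eqxx -scalerAl -scalerAr scalerA mulrC -scalerA.
    by rewrite (qxC n q (ltnSn i)).
- move=> a0; have ji : (i < j)%N by move: aE; rewrite a0; case: eqVneq => //; lia.
  rewrite a0 in vw wv; split.
    apply: comm_ee_gen => //.
    by apply: (sends_comm ev ew); evaluate (ev, ew, opE).
  move=> y; rewrite (inner_f_comm q_neq0 fv vw) //.
    by rewrite kVw -[RHS]scale1r; congr (_ *: _); scalar.
  by evaluate fw.
Qed.

Lemma related_CC (a : int) i j : (1 <= i < j)%N -> (j < n)%N ->
  a = (if j == i.+1 then -1 else 0) -> @related F n q a (TypeC i) (TypeC j).
Proof.
move=> /andP[i_gt0 ij] j_n aE sg c v sg' c' w c0 c'0 tv tw.
have vw : weight_rel q a v w.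
  apply: (weight_rel_types q_neq0 tv tw); left.
  by rewrite aE; case: eqVneq => ?; scalar.
have wv : weight_rel q a w v.
  apply: (weight_rel_types q_neq0 tw tv); left.
  by rewrite aE; case: eqVneq => ?; scalar.
have vv := weight_rel_self q_neq0 tv; have ww := weight_rel_self q_neq0 tw.
have ev k : ope v (x k) = if k == i.+1 then c *: x i else 0 by have [] := tv k.
have fv k : opf v (x k) = if k == i then c^-1 *: x i.+1 else 0 by have [] := tv k.
have ew k : ope w (x k) = if k == j.+1 then c' *: x j else 0 by have [] := tw k.
have fw k : opf w (x k) = if k == j then c'^-1 *: x j.+1 else 0 by have [] := tw k.
split=> //.
- split; [apply: (cross_rel_gen q_neq0 vw wv) | apply: (cross_rel_gen q_neq0 wv vw)].
    by apply: (sends_comm ev fw); evaluate (ev, fw, opE).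
  by apply: (sends_comm ew fv); evaluate (ew, fv, opE).
- move=> am; rewrite am in vw wv.
  have se : serre_on_gens (ope v) (ope w)
    by apply: (sends_serre ev ew); evaluate (ev, ew, opE).
  have sf : serre_on_gens (opf w) (opf v)
    by apply: (sends_serre fw fv); evaluate (fv, fw, opE).
  split; split.
  + by apply: serre_e_gen => // k; have [] := se k.
  + by apply: serre_e_gen => // k; have [] := se k.
  + by apply: serre_f_gen => // k; have [] := sf k.
  + by apply: serre_f_gen => // k; have [] := sf k.
- move=> a0; have ji : j != i.+1 by move: aE; rewrite a0; case: eqVneq.
  rewrite a0 in vw wv; split.
    apply: comm_ee_gen => //.
    by apply: (sends_comm ev ew); evaluate (ev, ew, opE).
  apply: comm_ff_gen => //.
  by apply: (sends_comm fv fw); evaluate (fv, fw, opE).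
Qed.

(** The mirror image of the pair A, C: now e_B is inner, for u = x_j, and e_C
    sends x_j to a multiple of x_i if j = i + 1, and to 0 otherwise. *)
Lemma related_CB (a : int) i j : (1 <= i < j)%N -> (j <= n)%N ->
  a = (if j == i.+1 then -1 else 0) -> @related F n q a (TypeC i) (TypeB j).
Proof.
move=> /andP[i_gt0 ij] j_n aE sg c v sg' c' w c0 c'0 tv tw.
have vw : weight_rel q a v w.
  apply: (weight_rel_types q_neq0 tv tw); left.
  by rewrite aE; case: eqVneq => ?; scalar.
have wv : weight_rel q a w v.
  apply: (weight_rel_types q_neq0 tw tv); left.
  by rewrite aE; case: eqVneq => ?; scalar.
have vv := weight_rel_self q_neq0 tv; have ww := weight_rel_self q_neq0 tw.
have ev k : ope v (x k) = if k == i.+1 then c *: x i else 0 by have [] := tv k.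
have fv k : opf v (x k) = if k == i then c^-1 *: x i.+1 else 0 by have [] := tv k.
have fw k : opf w (x k) = if k == j then c'%:A else 0 by have [] := tw k.
have ew := typeB_inner q_neq0 qV_neq c'0 tw.
have kv k : opk v (x k) = type_scal q (TypeC i) sg k *: x k by have [] := tv k.
have kw k : opk w (x k) = type_scal q (TypeB j) sg' k *: x k by have [] := tw k.
have kVv := has_type_kV q_neq0 tv.
split=> //.
- split.
    apply: (cross_rel_gen q_neq0 vw wv).
    by apply: (sends_comm ev fw); evaluate (ev, fw, opE).
  move=> y; apply/esym/eqP; rewrite -subr_eq0 (inner_e_cross q_neq0 ew wv).
    have -> : opf v (x j) = 0 by evaluate fv.
    by rewrite mulr0 mul0r subrr scaler0.
  by rewrite kVv aE; congr (_ *: _); case: eqVneq => ?; scalar.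
- move=> am; have ji : j = i.+1 by move: aE; rewrite am; case: eqVneq.
  rewrite am in vw wv; split; last first.
    have sr : serre_on_gens (opf w) (opf v)
      by apply: (sends_serre fw fv); evaluate (fv, fw, opE).
    by split; apply: serre_f_gen => // k; have [] := sr k.
  have [| | | |s1 s2] := inner_e_serre q_neq0 ew vv wv; last by split.
  + by rewrite kw; congr (_ *: _); scalar.
  + by rewrite kv; congr (_ *: _); scalar.
  + by evaluate (ev, opE).
  + rewrite ev ji eqxx -scalerAl -scalerAr scalerA mulrC -scalerA.
    by rewrite (qxC n q (ltnSn i)).
- move=> a0; have ji : j != i.+1 by move: aE; rewrite a0; case: eqVneq.
  rewrite a0 in vw wv; split; last first.
    apply: comm_ff_gen => //.
    by apply: (sends_comm fv fw); evaluate (fv, fw, opE).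
  move=> y; rewrite (inner_e_comm ew wv) //.
    by rewrite kv -[RHS]scale1r; congr (_ *: _); scalar.
  by evaluate ev.
Qed.

(** Here f_A is inner for x_1, and e_B is inner for x_n.  They commute although
    e_B(x_1) is not 0: it is a multiple of x_1 x_n, and k_A^-1(y) x_1 x_n equals
    x_1 x_n k_B(y).  The Serre relations are those of [inner_serre] with
    u' = 0. *)
Lemma related_AB : (1 < n)%N -> @related F n q (-1) (TypeA 1) (TypeB n).
Proof.
move=> n_gt1 sg c v sg' c' w c0 c'0 tv tw.
have vw : weight_rel q (-1) v w.
  by apply: (weight_rel_types q_neq0 tv tw); left; scalar.
have wv : weight_rel q (-1) w v.
  by apply: (weight_rel_types q_neq0 tw tv); left; scalar.
have vv := weight_rel_self q_neq0 tv; have ww := weight_rel_self q_neq0 tw.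
have ev k : ope v (x k) = if k == 1%N then c%:A else 0 by have [] := tv k.
have fw k : opf w (x k) = if k == n then c'%:A else 0 by have [] := tw k.
have fv := typeA_inner q_neq0 qV_neq c0 tv.
have ew := typeB_inner q_neq0 qV_neq c'0 tw.
have kv k : opk v (x k) = type_scal q (TypeA 1) sg k *: x k by have [] := tv k.
have kw k : opk w (x k) = type_scal q (TypeB n) sg' k *: x k by have [] := tw k.
have kVv := has_type_kV q_neq0 tv; have kVw := has_type_kV q_neq0 tw.
have wu : ope w (x 1) = - q / c' *: (x 1 * x n).
  by have [_ -> _] := tw 1%N; rewrite /type_e n_gt1.
have swap y : opkV v y * (x 1 * x n) = x 1 * x n * opk w y.
  (* The y with this property form a subalgebra; a generator only requires that
     k_A^-1 and k_B scale it according to its position relative to x_1 and x_n. *)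
  elim/qspace_ind: y => [|k /andP[k_gt0 k_n]|y z Hy Hz|y z Hy Hz|d y Hy].
  - by rewrite opkV1 opk1 mul1r mulr1.
  - rewrite kVv kw -scalerAl -scalerAr.
    have [->|k1] := eqVneq k 1%N.
      rewrite -(mulrA (x 1)) (qxC n q n_gt1) -scalerAr scalerA mulrA.
      by congr (_ *: _); scalar.
    have k_gt1 : (1 < k)%N by lia.
    rewrite mulrA (qxC n q k_gt1) -scalerAl scalerA.
    have [->|kn] := eqVneq k n.
      by congr (_ *: _); scalar.
    have k_ltn : (k < n)%N by lia.
    rewrite -!(mulrA (x 1)) (qxC n q k_ltn) -scalerAr scalerA.
    by congr (_ *: _); scalar.
  - by rewrite !linearD /= mulrDl mulrDr Hy Hz.
  - by rewrite opkVM opkM -mulrA Hz mulrA Hy !mulrA.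
  - by rewrite !linearZ /= -scalerAl Hy scalerAr.
split=> //.
- split.
    apply: (cross_rel_gen q_neq0 vw wv).
    by apply: (sends_comm ev fw); evaluate (ev, fw, opE).
  move=> y; apply/eqP; rewrite -subr_eq0 (inner_f_cross q_neq0 fv vw).
    by rewrite wu -scalerAl -scalerAr swap subrr scaler0.
  by rewrite kw; congr (_ *: _); scalar.
- have ev0 : ope v (x n) = 0 by evaluate ev.
  have fw0 : opf w (x 1) = 0 by evaluate fw.
  move=> _; split.
    have [| | | |s1 s2] := inner_e_serre q_neq0 ew vv wv; last by split.
    + by rewrite kw; congr (_ *: _); scalar.
    + by rewrite kv; congr (_ *: _); scalar.
    + by rewrite ev0 e0.
    + by rewrite ev0 mulr0 mul0r scaler0.
  have [| | | |s1 s2] := inner_f_serre q_neq0 fv ww vw; last by split.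
  + by rewrite kVv; congr (_ *: _); scalar.
  + by rewrite kVw; congr (_ *: _); scalar.
  + by rewrite fw0 f0.
  + by rewrite fw0 mulr0 mul0r scaler0.
Qed.

End PairRelations.

(** * Chains *)
Section Chains.
Variables (F : fieldType) (m n : nat) (q : F).

Lemma related_sym (a : int) t t' : @related F n q a t t' -> @related F n q a t' t.
Proof.
move=> tt' sg c v sg' c' w c0 c'0 tv tw.
exact/pair_relC/(tt' sg' c' w sg c v).
Qed.

Definition chain_rel (ty : nat -> action_type) :=
  (forall s, (s < m)%N -> type_ok n (ty s)) /\
  (forall s t, (s < t < m)%N ->
     @related F n q (if t == s.+1 then -1 else 0) (ty s) (ty t)).

Lemma chain_rel_rev ty : chain_rel ty -> chain_rel (fun s => ty (m - s.+1)%N).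
Proof.
case=> ok rel; split=> [s sm|s t /andP[st tm]]; first by apply: ok; lia.
apply: related_sym.
have -> : (t == s.+1) = (m - s.+1 == (m - t.+1).+1)%N by apply/idP/idP; lia.
by apply: rel; lia.
Qed.

Lemma chain_rel_eq ty ty' : (forall s, (s < m)%N -> ty s = ty' s) ->
  chain_rel ty' -> chain_rel ty.
Proof.
move=> e [ok rel]; split=> [s sm|s t /andP[st tm]]; first by rewrite e // ok.
by rewrite !e ?(ltn_trans st) //; apply: rel; rewrite st.
Qed.

Hypothesis q_neq0 : q != 0.
Hypothesis qV_neq : q - q^-1 != 0.

Lemma chain_rel_action ty (sg : 'I_m -> nat -> bool) (c : 'I_m -> F) :
  chain_rel ty -> (forall s, c s != 0) ->
  exists pi : Uq m q -> {linear qspace n q -> qspace n q},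
    module_algebra (@uq_comul _ m q) (@uq_counit _ m q) pi /\
    forall s : 'I_m, acts_as (ty s) (sg s) (c s)
      (pi (uqk q s)) (pi (uqe q s)) (pi (uqf q s)).
Proof.
move=> [ok rel] c0.
have /boolp.choice[v vP] : forall s : 'I_m, exists v : skew_sl2 (qspace n q),
    has_type (ty s) (sg s) (c s) v.
  by move=> s; apply: type_vertex => //; apply: ok.
have pairP (i j : 'I_m) : (i < j)%N -> pair_rel q (cartan i j) (v i) (v j).
  move=> ij; have -> : cartan i j = (if j == i.+1 :> nat then -1 else 0).
    rewrite /cartan; have -> : (i == j :> nat) = false by lia.
    by have -> : (i == j.+1 :> nat) = false by lia.
  by apply: rel (c0 i) (c0 j) (vP i) (vP j); rewrite ij ltn_ord.
have relv : forall t u, uq_rel q t u -> uq_exprop v t =1 uq_exprop v u.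
  apply: uq_exprop_relP => [i|i j].
    exact: type_vertex_rel (vP i).
  rewrite neq_ltn => /orP[|ji]; first exact: pairP.
  by rewrite cartanC; apply/pair_relC/pairP.
exists (uq_op v); split; first exact: uq_op_module_algebra.
move=> s; have := has_type_acts_as (vP s).
rewrite /acts_as => vs i i_n; move: (vs i i_n).
by rewrite !uq_op_gen.
Qed.

Hypothesis m_ge3 : (3 <= m)%N.
Hypothesis n_ge4 : (4 <= n)%N.

Lemma chain_rel_C i : (1 <= i)%N -> (i + m - 1 <= n - 1)%N ->
  chain_rel (fun s => TypeC (i + s)).
Proof.
move=> i_gt0 im; split=> [s sm|s t /andP[st tm]] /=; first by lia.
by apply: related_CC => //; try lia; congr (if _ then _ else _); lia.
Qed.

Lemma chain_rel_AC i : (1 <= i)%N -> (i + m - 2 <= n - 1)%N ->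
  chain_rel (fun s => if s is s'.+1 then TypeC (i + s') else TypeA i).
Proof.
move=> i_gt0 im; split=> [[|s] sm|[|s] [|t] /andP[st tm]] //=; try lia.
  by apply: related_AC => //; try lia; congr (if _ then _ else _); lia.
by apply: related_CC => //; try lia; congr (if _ then _ else _); lia.
Qed.

Lemma chain_rel_CB i : (1 <= i)%N -> (i + m - 2 <= n - 1)%N ->
  chain_rel (fun s => if (s < m - 1)%N then TypeC (i + s) else TypeB (i + m - 1)).
Proof.
move=> i_gt0 im; split=> [s sm|s t /andP[st tm]].
  by case: ifP => sm1 /=; lia.
have -> : (s < m - 1)%N by lia.
case: (ltnP t (m - 1)) => tm1.
  by apply: related_CC => //; try lia; congr (if _ then _ else _); lia.
by apply: related_CB => //; try lia; congr (if _ then _ else _); lia.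
Qed.

(** B_n is next to A_1 and to C_(n-1); A_1 commutes with the descending C_j
    because j > 1. *)
Lemma chain_rel_ABC : (1 < n + 2 - m)%N ->
  chain_rel (fun s => if s is s'.+1 then
                        if s' is s''.+1 then TypeC (n - s''.+1) else TypeB n
                      else TypeA 1).
Proof.
move=> nm; split=> [[|[|s]] sm|[|[|s]] [|[|t]] /andP[st tm]] //=; try lia.
- by apply: related_AB => //; lia.
- by apply: related_AC => //; try lia; case: eqVneq => //; lia.
- by apply/related_sym/related_CB => //; try lia; congr (if _ then _ else _); lia.
- by apply/related_sym/related_CC => //; try lia; congr (if _ then _ else _); lia.
Qed.

(** A_1 is next to B_n and to C_1; B_n commutes with the ascending C_j because
    j < n - 1. *)
Lemma chain_rel_BAC : (m - 2 < n - 1)%N ->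
  chain_rel (fun s => if s is s'.+1 then
                        if s' is s''.+1 then TypeC s''.+1 else TypeA 1
                      else TypeB n).
Proof.
move=> mn; split=> [[|[|s]] sm|[|[|s]] [|[|t]] /andP[st tm]] //=; try lia.
- by apply/related_sym/related_AB => //; lia.
- by apply/related_sym/related_CB => //; try lia; case: eqVneq => //; lia.
- by apply: related_AC => //; try lia; congr (if _ then _ else _); lia.
- by apply: related_CC => //; try lia; congr (if _ then _ else _); lia.
Qed.

Lemma action_chain_rel ch : action_chain m n ch ->
  size ch = m /\ chain_rel (nth TypeD ch).
Proof.
case=> [|i i_gt0 im|i i_gt0 im|i i_gt0 im|nm|mn].
- split; first by rewrite size_nseq.
  split=> [s sm|s t /andP[st tm]]; first by rewrite nth_nseq if_same.
  by rewrite !nth_nseq !if_same; apply: related_DD.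
- split; first by rewrite /= size_map size_iota; lia.
  apply: chain_rel_eq (chain_rel_AC i_gt0 im) => -[|s] sm //=.
  by rewrite (nth_map 0%N) ?size_iota ?nth_iota //; lia.
- split; first by rewrite size_rcons size_map size_iota; lia.
  apply: chain_rel_eq (chain_rel_CB i_gt0 im) => s sm.
  rewrite nth_rcons size_map size_iota; case: ifP => sm1.
    by rewrite (nth_map 0%N) ?size_iota ?nth_iota.
  by rewrite ifT //; lia.
- split; first by rewrite size_map size_iota.
  apply: chain_rel_eq (chain_rel_C i_gt0 im) => s sm.
  by rewrite (nth_map 0%N) ?size_iota ?nth_iota.
- split; first by rewrite /= size_map size_iota; lia.
  apply: chain_rel_eq (chain_rel_ABC nm) => -[|[|s]] sm //=.
  by rewrite (nth_map 0%N) ?size_iota ?nth_iota //; lia.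
- split; first by rewrite /= size_map size_iota; lia.
  apply: chain_rel_eq (chain_rel_BAC mn) => -[|[|s]] sm //=.
  by rewrite (nth_map 0%N) ?size_iota ?nth_iota //; lia.
Qed.

End Chains.

Theorem theorem5p4 (R : realType) (q : R[i]) (q_neq0 : q != 0)
    (q_not_root1 : forall r : nat, (0 < r)%N -> q ^+ r != 1)
    (m n : nat) (m_ge3 : (3 <= m)%N) (n_ge4 : (4 <= n)%N)
    (ch : seq action_type) (ch_chain : action_chain m n ch)
    (sg : 'I_m -> nat -> bool) (c : 'I_m -> R[i]) (c_neq0 : forall s, c s != 0) :
  (exists pi : Uq m q -> {linear qspace n q -> qspace n q},
     module_algebra (@uq_comul _ m q) (@uq_counit _ m q) pi /\
     acts_by_chain ch sg c pi) /\
  (exists pi : Uq m q -> {linear qspace n q -> qspace n q},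
     module_algebra (@uq_comul _ m q) (@uq_counit _ m q) pi /\
     acts_by_chain (rev ch) sg c pi).
Proof.
have qV_neq : q - q^-1 != 0.
  rewrite subr_eq0; apply: contra (q_not_root1 2%N isT) => /eqP qE.
  by rewrite expr2 {1}qE mulVf.
have [ch_m rel] := action_chain_rel q_neq0 qV_neq m_ge3 n_ge4 ch_chain.
have rel_rev : chain_rel m n q (nth TypeD (rev ch)).
  apply: chain_rel_eq (chain_rel_rev rel) => s sm.
  by rewrite nth_rev ch_m.
split; first exact: chain_rel_action.
exact: chain_rel_action.
Qed.
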